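(* Let $E$, $\mu$, $\mathcal{H}=L^2(E,\mu)$, the generalized Dirichlet form $\mathcal{E}$, its generator $(L,D(L))$ and its semigroup $(T_t)_{t>0}$ be as in the context. Suppose there exists a sectorial Dirichlet form $(\mathcal{E}^0,D(\mathcal{E}^0))$ on $L^2(E,\mu)$ such that $D(L)_b\subset D(\mathcal{E}^0)$ and $\mathcal{E}^0(u,u)\le \mathcal{E}(u,u)$ for any $u\in D(L)_b$. Then the transience of $(\mathcal{E}^0,D(\mathcal{E}^0))$ implies the transience of $(T_t)_{t>0}$.
   Context: $E$ is a Hausdorff topological space whose Borel $\sigma$-algebra $\mathcal{B}(E)$ is generated by the continuous functions on $E$; $\mu$ is a $\sigma$-finite positive measure on $\mathcal{B}(E)$; $\mathcal{H}:=L^2(E,\mu)$ with inner product $(\cdot,\cdot)$. For a set $W$ of functions on $E$, $W_b$ denotes the set of $\mu$-a.e. bounded elements of $W$. An operator $S$ is sub-Markovian if $0\le f\le 1$ implies $0\le Sf\le 1$; a resolvent $(G_\alpha)_{\alpha>0}$ is sub-Markovian if all $\alpha G_\alpha$ are. Dirichlet forms. A (not necessarily symmetric) Dirichlet form on $\mathcal{H}$ is a bilinear form $\mathcal{A}$ on a dense linear subspace $\mathcal{V}\subset\mathcal{H}$ with $\mathcal{A}(u,u)\ge 0$, such that $\mathcal{V}$ is complete for the norm $\|u\|_{\mathcal{V}}=(\mathcal{A}(u,u)+(u,u))^{1/2}$, the weak sector condition $|\mathcal{A}_1(u,v)|\le K\mathcal{A}_1(u,u)^{1/2}\mathcal{A}_1(v,v)^{1/2}$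 holds for some $K>0$ (with $\mathcal{A}_1=\mathcal{A}+(\cdot,\cdot)$), and for all $u\in\mathcal{V}$: $u^+\wedge 1\in\mathcal{V}$, $\mathcal{A}(u+u^+\wedge 1,u-u^+\wedge 1)\ge 0$ and $\mathcal{A}(u-u^+\wedge 1,u+u^+\wedge 1)\ge 0$. It is called sectorial if it moreover satisfies the strong sector condition $|\mathcal{A}(u,v)|\le K\mathcal{A}(u,u)^{1/2}\mathcal{A}(v,v)^{1/2}$ for some $K>0$ and all $u,v$. Framework. $(\mathcal{A},\mathcal{V})$ is a (not necessarily symmetric) Dirichlet form on $\mathcal{H}$, $\mathcal{V}'$ is the dual of $\mathcal{V}$ (with $\mathcal{V}\subset\mathcal{H}\subset\mathcal{V}'$), and $(\Lambda,D(\Lambda,\mathcal{H}))$ is a linear operator on $\mathcal{H}$ which generates a sub-Markovian $C_0$-semigroup of contractions on $\mathcal{H}$ that can be restricted to a $C_0$-semigroup on $\mathcal{V}$. Then $\Lambda:D(\Lambda,\mathcal{H})\cap\mathcal{V}\to\mathcal{V}'$ is closable as an operator from $\mathcal{V}$ to $\mathcal{V}'$; its closure is denoted $(\Lambda,\mathcal{F})$. The associated generalized Dirichlet form satisfies $\mathcal{E}(u,v)=\mathcal{A}(u,v)-{}_{\mathcal{V}'}\langle\Lambda u,v\rangle_{\mathcal{V}}$ for $u\in\mathcal{F}$, $v\in\mathcal{V}$. $(G_\alpha)_{\alpha>0}$ is the sub-Markovian $C_0$-resolvent of contractions on $\mathcal{H}$ with $G_\alpha(\mathcal{H})\subset\mathcal{F}$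 and $\mathcal{E}(G_\alpha f,g)+\alpha(G_\alpha f,g)=(f,g)$ for $f\in\mathcal{H}$, $g\in\mathcal{V}$; $(\widehat{G}_\alpha)_{\alpha>0}$ is its adjoint; $(L,D(L))$ is the generator of $(G_\alpha)_{\alpha>0}$ (so $\mathcal{E}(u,u)=(-Lu,u)$ for $u\in D(L)$); $(T_t)_{t>0}$ and $(\widehat{T}_t)_{t>0}$ are the $C_0$-semigroups of contractions corresponding to $(G_\alpha)_{\alpha>0}$ and $(\widehat{G}_\alpha)_{\alpha>0}$. It is assumed that $(\widehat{T}_t)_{t>0}$ is sub-Markovian. Hence $(T_t)_{t>0}$ restricted to $L^1(E,\mu)\cap L^2(E,\mu)$ extends to a positivity preserving semigroup of contractions on $L^1(E,\mu)$, also denoted $(T_t)_{t>0}$. Potential operator and transience. For $f\in L^1(E,\mu)$, $f\ge 0$, the potential operator is $Gf:=\lim_{N\to\infty}\int_0^N T_tf\,dt=\lim_{\alpha\to 0}\int_0^\infty e^{-\alpha t}T_tf\,dt\in[0,\infty]$ ($\mu$-a.e. defined). $(T_t)_{t>0}$ is transient if there is $g\in L^1(E,\mu)$, $g>0$ $\mu$-a.e., with $Gg<\infty$ $\mu$-a.e. A Dirichlet form $(\mathcal{E}^0,D(\mathcal{E}^0))$ is called transient if its associated semigroup is transient in the same sense. *)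

(* Defs.v *)
From HB Require Import structures.
From mathcomp Require Import all_boot all_order all_algebra.
From mathcomp Require Import all_classical all_reals all_analysis.
From mathcomp Require Import measurable_realfun ess_sup_inf.

Set Implicit Arguments.
Unset Strict Implicit.
Unset Printing Implicit Defensive.

Import Order.TTheory GRing.Theory Num.Theory.
Import numFieldNormedType.Exports.

Local Open Scope classical_set_scope.
Local Open Scope ring_scope.

(* [LspaceType mu p1] is the library's type of a.e.-classes of functions with
   finite p-norm; it comes without any algebraic structure, so we make it a
   [normedModType R] here. *)
Section Lspace_normed_module.
Context d (T : measurableType d) (R : realType).
Variables (mu : {measure set T -> \bar R}) (p : \bar R) (p1 : (1 <= p)%E).

Local Notation Lp := (LspaceType mu p1).
Local Notation Lf := (LfunType mu p1).
Local Notation cls := {mfun_ mu, T >-> measurableTypeR R}.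

HB.instance Definition _ := gen_eqMixin Lp.
HB.instance Definition _ := gen_choiceMixin Lp.

Lemma ae_finite_norm (f g : {mfun T >-> R}) : f = g %[ae mu] ->
  'N[mu]_p[EFin \o f]%E = 'N[mu]_p[EFin \o g]%E.
Proof.
move=> fg; rewrite unlock /Lnorm.
have p0 : (0 < p)%E by rewrite (lt_le_trans _ p1).
case: p p0 => [r r0|_|//].
- have mpow (h : {mfun T >-> R}) :
    @measurable_fun _ _ T (\bar R) setT (fun x => `|(EFin \o h) x| `^ r)%E.
    apply: (measurableT_comp (measurable_poweR _)) => //.
    by apply: measurableT_comp => //; exact/measurable_EFinP.
  congr (_ `^ _)%E; apply: ge0_ae_eq_integral => //.
  + by move=> x _; exact: poweR_ge0.
  + by move=> x _; exact: poweR_ge0.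
  + by apply: filterS fg => x fgx xT /=; rewrite fgx.
- case: ifP => // _; apply: eq_ess_sup.
  by apply: filterS fg => x fgx /=; rewrite (fgx I).
Qed.

Lemma Lspace_repr_subproof (x : Lp) : (x : T -> R) \in Lfun mu p.
Proof.
case: x => x [[fx]] /=; apply/andP; split; rewrite inE /=.
  exact: (measurable_funPT (repr x)).
exact: fx.
Qed.

Definition Lrepr (x : Lp) : Lf := Lfun_Sub p1 (Lspace_repr_subproof x).

(* The library has two canonical measurable structures on R, with the same
   sets but different displays: the one of [LfunType] and [measurableTypeR]. *)
Definition mfunTR (f : Lf) : {mfun T >-> measurableTypeR R} :=
  MeasurableFun.Pack (MeasurableFun.Class
    (isMeasurableFun.Build _ _ _ (measurableTypeR R) f (measurable_funPT f))).

Lemma repr_pi_mfunTR (f : Lf) : repr (\pi_cls (mfunTR f))%qT = f %[ae mu].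
Proof. by have /eqmodP/asboolP := reprK (\pi_cls (mfunTR f))%qT. Qed.

Lemma Lclass_subproof (f : Lf) : finite_norm mu p ((\pi_cls (mfunTR f))%qT : cls).
Proof.
rewrite /finite_norm.
have m : measurable_fun setT (((\pi_cls (mfunTR f))%qT : cls) : T -> R).
  exact: (measurable_funPT (repr (\pi_cls (mfunTR f))%qT)).
pose g : {mfun T >-> R} := HB.pack_for {mfun T >-> R}
  (((\pi_cls (mfunTR f))%qT : cls) : T -> R) (isMeasurableFun.Build _ _ _ _ _ m).
rewrite -[ltLHS]/('N[mu]_p[EFin \o g])%E (@ae_finite_norm g f).
  exact: Lfunction_finite.
exact: repr_pi_mfunTR.
Qed.

Definition Lclass (f : Lf) : Lp :=
  LebesgueSpace.Pack (LebesgueSpace.Class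
    (isFinLebesgue.Build _ _ _ _ _ p1 _ (Lclass_subproof f))).

Lemma Lclass_eqP (x y : Lp) :
  LebesgueSpace.sort x = LebesgueSpace.sort y -> x = y.
Proof.
case: x => x [[fx]]; case: y => y [[fy]] /= xy.
by case: _ / xy in fy *; congr (LebesgueSpace.Pack _); congr LebesgueSpace.Class;
  congr isFinLebesgue.Axioms_; exact: Prop_irrelevance.
Qed.

Lemma LreprK : cancel Lrepr Lclass.
Proof.
move=> x; apply: Lclass_eqP => /=.
rewrite -[RHS]reprK; apply/eqmodP/asboolP.
exact: nearW.
Qed.

Lemma LclassK (f : Lf) : Lrepr (Lclass f) = f %[ae mu].
Proof.
exact: repr_pi_mfunTR.
Qed.

Lemma LclassP (f g : Lf) : f = g %[ae mu] -> Lclass f = Lclass g.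
Proof. by move=> fg; apply: Lclass_eqP; apply/eqmodP/asboolP. Qed.

Lemma LspaceP (x y : Lp) : (x : T -> R) = y %[ae mu] -> x = y.
Proof. by move=> xy; rewrite -[x]LreprK -[y]LreprK; exact: LclassP. Qed.

Definition Lzero : Lp := Lclass 0.
Definition Lopp (x : Lp) : Lp := Lclass (- Lrepr x).
Definition Ladd (x y : Lp) : Lp := Lclass (Lrepr x + Lrepr y).
Definition Lscale (a : R) (x : Lp) : Lp := Lclass (a *: Lrepr x).

Lemma LaddE (f g : Lf) : Ladd (Lclass f) (Lclass g) = Lclass (f + g).
Proof.
apply: LclassP; move: (LclassK f) (LclassK g); apply: filterS2 => x fx gx xT.
exact: (f_equal2 +%R (fx xT) (gx xT)).
Qed.

Lemma LoppE (f : Lf) : Lopp (Lclass f) = Lclass (- f).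
Proof.
apply: LclassP; move: (LclassK f); apply: filterS => x fx xT.
exact: (f_equal -%R (fx xT)).
Qed.

Lemma LscaleE a (f : Lf) : Lscale a (Lclass f) = Lclass (a *: f).
Proof.
apply: LclassP; move: (LclassK f); apply: filterS => x fx xT.
exact: (f_equal ( *%R a) (fx xT)).
Qed.

Let LaddA : associative Ladd.
Proof.
by move=> x y z; rewrite -[x]LreprK -[y]LreprK -[z]LreprK !LaddE addrA.
Qed.

Let LaddC : commutative Ladd.
Proof. by move=> x y; rewrite /Ladd addrC. Qed.

Let Ladd0 : left_id Lzero Ladd.
Proof. by move=> x; rewrite -[x]LreprK LaddE add0r. Qed.

Let LaddN : left_inverse Lzero Lopp Ladd.
Proof. by move=> x; rewrite -[x]LreprK LoppE LaddE addNr. Qed.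

HB.instance Definition _ := GRing.isZmodule.Build Lp LaddA LaddC Ladd0 LaddN.

Let LscaleA a b (x : Lp) : Lscale a (Lscale b x) = Lscale (a * b) x.
Proof. by rewrite -[x]LreprK !LscaleE scalerA. Qed.

Let Lscale1 : left_id 1 Lscale.
Proof. by move=> x; rewrite -[x]LreprK LscaleE scale1r. Qed.

Let LscaleDr : right_distributive Lscale +%R.
Proof.
move=> a x y; change (Lscale a (Ladd x y) = Ladd (Lscale a x) (Lscale a y)).
by rewrite -[x]LreprK -[y]LreprK !(LaddE, LscaleE) scalerDr.
Qed.

Let LscaleDl x : {morph Lscale^~ x : a b / a + b}.
Proof.
move=> a b; change (Lscale (a + b) x = Ladd (Lscale a x) (Lscale b x)).
by rewrite -[x]LreprK !(LaddE, LscaleE) scalerDl.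
Qed.

HB.instance Definition _ :=
  GRing.Zmodule_isLmodule.Build R Lp LscaleA Lscale1 LscaleDr LscaleDl.

Definition Lspace_norm (x : Lp) : R := fine ('N[mu]_p[EFin \o Lrepr x])%E.

Lemma Lspace_norm_class (f : Lf) :
  Lspace_norm (Lclass f) = fine ('N[mu]_p[EFin \o f])%E.
Proof. by rewrite /Lspace_norm (@ae_finite_norm _ f)//; exact: LclassK. Qed.

Let Lnorm_triangle (x y : Lp) :
  Lspace_norm (x + y) <= Lspace_norm x + Lspace_norm y.
Proof.
by rewrite -[x + y]/(Ladd x y) Lspace_norm_class; exact: ler_LnormD.
Qed.

Let Lnorm_scale (a : R) (x : Lp) :
  Lspace_norm (a *: x) = `|a| * Lspace_norm x.
Proof.
rewrite -[a *: x]/(Lscale a x) Lspace_norm_class; apply/EFin_inj.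
by rewrite EFinM !finite_norm_fine; exact: LnormZ.
Qed.

Let Lnorm_eq0 (x : Lp) : Lspace_norm x = 0 -> x = 0.
Proof.
by move=> /fine_Lnormr_eq0 x0; rewrite -[x]LreprK; exact: LclassP.
Qed.

HB.instance Definition _ :=
  Lmodule_isNormed.Build R Lp Lnorm_triangle Lnorm_scale Lnorm_eq0.

End Lspace_normed_module.

Notation L1 mu := (LspaceType mu (@lexx _ _ 1%E)).
Notation L2 mu := (LspaceType mu (lee1n 2)).

(* Linear operators on a normed space.  One-parameter families are indexed by
   all of [R]; only the parameters [0 <= t] (semigroups, with the convention
   that the operator at time 0 is the identity) and [0 < a] (resolvents) are
   ever constrained or used. *)
Section semigroups_and_resolvents.
Context {R : realType} {B : normedModType R}.
Implicit Types (T G : R -> {linear B -> B}).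

(* [I] is the Riemann integral of the curve [c] over [a, b]: tagged Riemann sums
   converge to [I] in norm as the mesh of the partition tends to 0. *)
Definition is_integral (c : R -> B) (a b : R) (I : B) : Prop :=
  forall e : R, 0 < e -> exists2 delta : R, 0 < delta &
    forall (n : nat) (x xi : nat -> R), x 0%N = a -> x n = b ->
      (forall i, (i < n)%N ->
        [/\ x i <= xi i, xi i <= x i.+1 & x i.+1 - x i < delta]) ->
      `|\sum_(i < n) (x i.+1 - x i) *: c (xi i) - I| < e.

Definition C0_contraction_semigroup T : Prop :=
  [/\ forall f, T 0 f = f,
      forall (s t : R) f, 0 <= s -> 0 <= t -> T (s + t) f = T s (T t f),
      forall (t : R) f, 0 <= t -> `|T t f| <= `|f| &
      forall f, T t f @[t --> 0^'+] --> f].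

Definition C0_contraction_resolvent G : Prop :=
  [/\ forall (a b : R) f, 0 < a -> 0 < b -> G a f - G b f = (b - a) *: G a (G b f),
      forall (a : R) f, 0 < a -> `|a *: G a f| <= `|f| &
      forall f, a *: G a f @[a --> +oo] --> f].

Definition semigroup_generator T (D : set B) (L : B -> B) : Prop :=
  forall u w, (D u /\ L u = w) <->
    (t^-1 *: (T t u - u) @[t --> 0^'+] --> w).

(* u \in D(L) and L u = w iff (a - L) u = a u - w is mapped to u by G_a. *)
Definition resolvent_generator G (D : set B) (L : B -> B) : Prop :=
  forall u w, (D u /\ L u = w) <->
    (forall a : R, 0 < a -> G a (a *: u - w) = u).

(* G_a f = \int_0^oo e^(-a t) T_t f dt *)
Definition semigroup_resolvent T G : Prop :=
  forall (a : R) f, 0 < a -> exists I : R -> B,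
    (forall M : R, 0 <= M ->
       is_integral (fun t => expR (- (a * t)) *: T t f) 0 M (I M)) /\
    (I M @[M --> +oo] --> G a f).

End semigroups_and_resolvents.

Section Dirichlet_forms.
Context {d : measure_display} {X : measurableType d} {R : realType}.
Variable mu : {measure set X -> \bar R}.
Local Notation H := (L2 mu).
Local Notation H1 := (L1 mu).

Definition dot (f g : H) : R := \int[mu]_x (f x * g x).

Definition ae_bounded (u : H) : Prop :=
  exists M : R, {ae mu, forall x, `|u x| <= M}.

Definition sub_Markovian (S : H -> H) : Prop :=
  forall f : H, {ae mu, forall x, 0 <= f x <= 1} ->
    {ae mu, forall x, 0 <= S f x <= 1}.

Lemma unit_contraction_subproof (u : H) :
  (fun x => Num.min (Num.max (u x) 0) 1) \in Lfun mu 2%:E.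
Proof.
have mu_ : measurable_fun setT (u : X -> R) := measurable_funPT (Lrepr u).
set v := (X in X \in _).
have mv : measurable_fun setT v.
  by apply: measurable_minr => //; exact: measurable_maxr.
have v_le x : `|v x| <= `|u x|.
  rewrite ger0_norm ?le_min ?le_max ?lexx ?orbT ?ler01// ge_min ge_max.
  by rewrite ler_norm normr_ge0.
have mpow (h : X -> R) : measurable_fun setT h ->
    @measurable_fun _ _ X (\bar R) setT (fun x => `|(EFin \o h) x| `^ 2)%E.
  move=> mh; apply: (measurableT_comp (measurable_poweR _)) => //.
  by apply: measurableT_comp => //; exact/measurable_EFinP.
apply/andP; split; rewrite inE//=.
have := @Lfunction_finite _ _ _ _ _ (lee1n 2) (Lrepr u).
rewrite /finite_norm; apply: le_lt_trans; rewrite unlock.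
rewrite gt0_ler_poweR//.
- by rewrite in_itv/= leey integral_ge0// => x _; exact: poweR_ge0.
- by rewrite in_itv/= leey integral_ge0// => x _; exact: poweR_ge0.
rewrite ge0_le_integral//.
- by move=> x _; exact: poweR_ge0.
- exact: mpow.
- exact: mpow.
move=> x _; apply: gt0_ler_poweR => //.
- by rewrite in_itv/= leey lee_fin normr_ge0.
- by rewrite in_itv/= leey lee_fin normr_ge0.
- by rewrite /= lee_fin; exact: v_le.
Qed.

(* u^+ /\ 1 *)
Definition unit_contraction (u : H) : H :=
  Lclass (Lfun_Sub (lee1n 2) (unit_contraction_subproof u)).

Implicit Types (A : H -> H -> R) (V : set H).

Definition form1 A (u v : H) : R := A u v + dot u v.

Definition form_norm A (u : H) : R := Num.sqrt (form1 A u u).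

Record Dirichlet_form A V : Prop := {
  form_dom0 : V 0 ;
  form_domP : forall (a : R) u v, V u -> V v -> V (a *: u + v) ;
  form_dom_dense : dense V ;
  form_linl : forall (a : R) u v w, V u -> V v -> V w ->
    A (a *: u + v) w = a * A u w + A v w ;
  form_linr : forall (a : R) u v w, V u -> V v -> V w ->
    A w (a *: u + v) = a * A w u + A w v ;
  form_ge0 : forall u, V u -> 0 <= A u u ;
  form_complete : forall u_ : nat -> H, (forall n, V (u_ n)) ->
    (forall e : R, 0 < e -> exists N : nat, forall m n : nat,
       (N <= m)%N -> (N <= n)%N -> form_norm A (u_ m - u_ n) < e) ->
    exists2 u, V u & form_norm A (u_ n - u) @[n --> \oo] --> 0 ;
  form_weak_sector : exists2 K : R, 0 < K & forall u v, V u -> V v ->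
    `|form1 A u v| <= K * Num.sqrt (form1 A u u) * Num.sqrt (form1 A v v) ;
  form_unit_contraction : forall u, V u ->
    [/\ V (unit_contraction u),
        0 <= A (u + unit_contraction u) (u - unit_contraction u) &
        0 <= A (u - unit_contraction u) (u + unit_contraction u)]
}.

Definition sectorial A V : Prop :=
  exists2 K : R, 0 < K & forall u v, V u -> V v ->
    `|A u v| <= K * Num.sqrt (A u u) * Num.sqrt (A v v).

(* The family U restricts to a C_0-semigroup of bounded operators on V. *)
Definition restricts_to_C0_semigroup A V (U : R -> {linear H -> H}) : Prop :=
  [/\ forall (t : R) u, 0 <= t -> V u -> V (U t u),
      forall t : R, 0 <= t -> exists C : R, forall u, V u ->
        form_norm A (U t u) <= C * form_norm A u &
      forall u, V u -> form_norm A (U t u - u) @[t --> 0^'+] --> 0].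

(* Elements of V' are represented by functions H -> R, of which only the
   restriction to V matters; h \in H is the element (h, .) of V'. *)
Definition in_dual A V (phi : H -> R) : Prop :=
  (forall (a : R) u v, V u -> V v -> phi (a *: u + v) = a * phi u + phi v) /\
  (exists C : R, forall v, V v -> `|phi v| <= C * form_norm A v).

(* (u, phi) is in the closure in V x V' of the graph of
   Lam : D `&` V -> V'; in the last clause h_n := Lam u_n converges to phi
   in V'. *)
Definition closure_graph A V (D : set H) (Lam : H -> H) (u : H) (phi : H -> R)
    : Prop :=
  [/\ V u, in_dual A V phi &
      exists u_ : nat -> H,
        [/\ forall n, (D `&` V) (u_ n),
            form_norm A (u_ n - u) @[n --> \oo] --> 0 &
            forall e : R, 0 < e -> exists N : nat, forall n, (N <= n)%N ->
              forall v, V v ->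
                `|dot (Lam (u_ n)) v - phi v| <= e * form_norm A v]].

(* The domain F of the closure of Lam : D `&` V -> V'. *)
Definition closure_dom A V D Lam : set H :=
  [set u | exists phi, closure_graph A V D Lam u phi].

(* The closure itself, as u |-> <Lam u, .>.  On V the value does not depend on
   the choice made by [get] when Lam is closable. *)
Definition closure_op A V D Lam (u : H) : H -> R :=
  get [set phi | closure_graph A V D Lam u phi].

(* E(u, v) = A(u, v) - <Lam u, v>, meaningful for u \in F and v \in V. *)
Definition gen_form A V D Lam (u v : H) : R :=
  A u v - closure_op A V D Lam u v.

Definition gen_form_resolvent A V D Lam (G : R -> {linear H -> H}) : Prop :=
  forall (a : R) f, 0 < a -> closure_dom A V D Lam (G a f) /\
    forall g, V g ->
      gen_form A V D Lam (G a f) g + a * dot (G a f) g = dot f g.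

Definition form_resolvent A V (G : R -> {linear H -> H}) : Prop :=
  forall (a : R) f, 0 < a -> V (G a f) /\
    forall g, V g -> A (G a f) g + a * dot (G a f) g = dot f g.

Definition adjoint_family (G Gh : R -> {linear H -> H}) : Prop :=
  forall (a : R) f g, 0 < a -> dot (G a f) g = dot f (Gh a g).

(* T1 is the extension to L^1 of the restriction of T to L^1 \cap L^2, a
   positivity preserving semigroup of contractions. *)
Record L1_extension (T : R -> {linear H -> H}) (T1 : R -> {linear H1 -> H1})
    : Prop := {
  L1_extends : forall (t : R) (f : H1) (h : H), 0 <= t ->
    (f : X -> R) = h %[ae mu] -> (T1 t f : X -> R) = T t h %[ae mu] ;
  L1_contraction : forall (t : R) (f : H1), 0 <= t -> `|T1 t f| <= `|f| ;
  L1_semigroup : forall (s t : R) (f : H1), 0 <= s -> 0 <= t ->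
    T1 (s + t) f = T1 s (T1 t f) ;
  L1_positivity : forall (t : R) (f : H1), 0 <= t ->
    {ae mu, forall x, 0 <= f x} -> {ae mu, forall x, 0 <= T1 t f x}
}.

(* Gf = lim_N \int_0^N T_t f dt a.e., the integral being taken in L^1 *)
Definition is_potential (T1 : R -> {linear H1 -> H1}) (f : H1)
    (Gf : X -> \bar R) : Prop :=
  exists I : nat -> H1,
    (forall N : nat, is_integral (fun t => T1 t f) 0 N%:R (I N)) /\
    {ae mu, forall x, (I N x)%:E @[N --> \oo] --> Gf x}.

Definition transient (T1 : R -> {linear H1 -> H1}) : Prop :=
  exists2 g : H1, {ae mu, forall x, 0 < g x} &
    exists2 Gg : X -> \bar R, is_potential T1 g Gg &
      {ae mu, forall x, (Gg x < +oo)%E}.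

(* The resolvent, the semigroup and its extension to L^1 are determined by the
   form, so the existential quantifier only names them. *)
Definition transient_form A V : Prop :=
  exists (G T : R -> {linear H -> H}) (T1 : R -> {linear H1 -> H1}),
    [/\ C0_contraction_resolvent G /\ form_resolvent A V G,
        C0_contraction_semigroup T /\ semigroup_resolvent T G,
        L1_extension T T1 & transient T1].

End Dirichlet_forms.

(* The Borel sigma-algebra of [E]. *)
Notation borelType E := (g_sigma_algebraType (@open E)).

Definition borel_generated_by_continuous (R : realType) (E : ptopologicalType)
    : Prop :=
  (measurable : set (set (borelType E))) =
  <<s \bigcup_(f in [set f : E -> R | continuous f])
        preimage_set_system setT f measurable >>.

(* Main.v *)
Require Import Defs.
From HB Require Import structures.
From mathcomp Require Import all_boot all_order all_algebra.
From mathcomp Require Import all_classical all_reals all_analysis.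
From mathcomp Require Import measurable_realfun.
From mathcomp Require Import lra ring.

Set Implicit Arguments.
Unset Strict Implicit.
Unset Printing Implicit Defensive.

Import Order.TTheory GRing.Theory Num.Theory.
Import numFieldNormedType.Exports.

Local Open Scope classical_set_scope.
Local Open Scope ring_scope.

(**
  Transience of E0 yields an integrable weight p with 0 < p <= 1 and
  (G0_a p, p) <= M for all a > 0.  Put v = G0_a p.  Then E0(v, v) <= M and
  a |v|^2 <= M, so the strong sector condition applied to
  (p, u) = E0(v, u) + a (v, u) gives (p, u) <= C E0(u, u)^(1/2) as a -> 0.

  Now take g = p^2 <= p and u = G_a g, a bounded element of D(L).  By the
  domination hypothesis E0(u, u) <= E(u, u) <= (g, u) <= (p, u), hence
  (p, u) <= C (p, u)^(1/2), that is (p, G_a g) <= C^2 uniformly in a.  Since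
  the integral of T_t g over [0, N] is at most e G_{1/N} g, monotone
  convergence shows that Gg is integrable against p > 0, so Gg < oo a.e.

  The choice g = p^2 makes t |-> T_t g continuous in L^1, so that its Riemann
  integrals exist by completeness of L^1.
*)

(** * Riemann sums in normed modules *)

Section riemann_sums.
Context {R : realType}.

Definition tagged_partition (a b delta : R) (n : nat) (x xi : nat -> R) : Prop :=
  [/\ x 0%N = a, x n = b & forall i, (i < n)%N ->
      [/\ x i <= xi i, xi i <= x i.+1 & x i.+1 - x i < delta]].

Lemma partition_le a b delta n x xi : tagged_partition a b delta n x xi ->
  forall i j, (i <= j <= n)%N -> x i <= x j.
Proof.
move=> [_ _ xP] i; elim=> [|j IH]; first by rewrite leqn0 => /andP[/eqP->].
rewrite leq_eqVlt => /andP[/orP[/eqP->//|ij] jn].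
have [h1 h2 _] := xP _ jn.
rewrite (le_trans (IH _)) ?(le_trans h1)//.
by rewrite -ltnS ij ltnW.
Qed.

Lemma partition_bounds a b delta n x xi i :
  tagged_partition a b delta n x xi -> (i <= n)%N -> a <= x i <= b.
Proof.
move=> P ni; have [<- <- _] := P.
by rewrite !(partition_le P)//= ni leqnn.
Qed.

Lemma uniform_partition (a b delta : R) : a <= b -> 0 < delta ->
  exists n x xi, tagged_partition a b delta n x xi.
Proof.
(* One more than the integer part of [(b - a) / delta], which makes the mesh strictly smaller than
   [delta]. *)
move=> ab d0; pose n := (Num.truncn ((b - a) / delta)).+1.
have n0 : 0 < n%:R :> R by rewrite ltr0n.
exists n, (fun i => a + i%:R * ((b - a) / n%:R)), (fun i => a + i%:R * ((b - a) / n%:R)).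
have step : 0 <= (b - a) / n%:R by rewrite divr_ge0 ?subr_ge0// ltW.
have dn : (b - a) / n%:R < delta.
  by rewrite ltr_pdivrMr// mulrC -ltr_pdivrMr// truncnS_gt.
split=> [||i _]; first by rewrite mul0r addr0.
  by rewrite mulrC divfK ?gt_eqF// addrC subrK.
by split => //; rewrite -natr1; lra.
Qed.

(** The length of the intersection of the intervals [[x, x']] and [[y, y']], equal to 0 when they
    are disjoint. *)
Let overlap (x x' y y' : R) : R := Num.max 0 (Num.min x' y' - Num.max x y).

Let overlapC x x' y y' : overlap x x' y y' = overlap y y' x x'.
Proof. by rewrite /overlap minC (maxC x). Qed.

Let overlap_ge0 x x' y y' : 0 <= overlap x x' y y'.
Proof. by rewrite /overlap le_max lexx. Qed.

(** The right-hand side is the increment of a single function, clipping to [[x, x']], between [y]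
    and [y']; summed over the cells of a partition it telescopes. *)
Let overlap_clip x x' y y' : x <= x' -> y <= y' ->
  overlap x x' y y' = Num.min (Num.max y' x) x' - Num.min (Num.max y x) x'.
Proof.
move=> xx yy; rewrite /overlap.
by case: (leP x' y'); case: (leP x y); case: (leP y' x) => *;
  repeat case: leP => * ; lra.
Qed.

Let overlap_sum a b delta m y eta x x' : tagged_partition a b delta m y eta ->
  a <= x -> x <= x' -> x' <= b -> \sum_(j < m) overlap x x' (y j) (y j.+1) = x' - x.
Proof.
move=> P ax xx xb.
under eq_bigr => j _.
  rewrite overlap_clip//; last first.
    by apply: (partition_le P); rewrite leqnSn ltn_ord.
  over.
have [ya yb _] := P.
rewrite -(big_mkord xpredT (fun j => Num.min (Num.max (y j.+1) x) x' -
  Num.min (Num.max (y j) x) x')).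
rewrite telescope_sumr// ya yb; repeat case: leP => * ; lra.
Qed.

Context {B : normedModType R}.
Implicit Types c : R -> B.

Definition riemann_sum c n (x xi : nat -> R) : B :=
  \sum_(i < n) (x i.+1 - x i) *: c (xi i).

Lemma is_integralP c a b I : is_integral c a b I <->
  forall e : R, 0 < e -> exists2 delta : R, 0 < delta & forall n x xi,
    tagged_partition a b delta n x xi -> `|riemann_sum c n x xi - I| < e.
Proof.
split=> cI e /cI[delta d0 dP]; exists delta => // n x xi; first by case=> *; apply: dP.
by move=> *; apply: dP.
Qed.

(* Both sums are written over the common refinement: the cells [i] and [j]
   contribute the length of their overlap, which vanishes unless the two tags
   are closer than the sum of the meshes. *)
Lemma riemann_sum_dist c a b e d d' n x xi m y eta : 0 <= e ->
  (forall s t, a <= s <= b -> a <= t <= b -> `|s - t| < d + d' ->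
     `|c s - c t| <= e) ->
  tagged_partition a b d n x xi -> tagged_partition a b d' m y eta ->
  `|riemann_sum c n x xi - riemann_sum c m y eta| <= (b - a) * e.
Proof.
move=> e0 cP P Q.
pose l (i j : nat) := overlap (x i) (x i.+1) (y j) (y j.+1).
have [xa xb xP] := P; have [ya yb yP] := Q.
have xb_ i : (i <= n)%N -> a <= x i <= b by exact: (partition_bounds P).
have yb_ i : (i <= m)%N -> a <= y i <= b by exact: (partition_bounds Q).
have lx (i : 'I_n) : \sum_(j < m) l i j = x i.+1 - x i.
  apply: (overlap_sum Q).
  - by case/andP: (xb_ i (ltnW (ltn_ord i))).
  - by apply: (partition_le P); rewrite leqnSn ltn_ord.
  - by case/andP: (xb_ i.+1 (ltn_ord i)).
have ly (j : 'I_m) : \sum_(i < n) l i j = y j.+1 - y j.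
  under eq_bigr do rewrite /l overlapC.
  apply: (overlap_sum P).
  - by case/andP: (yb_ j (ltnW (ltn_ord j))).
  - by apply: (partition_le Q); rewrite leqnSn ltn_ord.
  - by case/andP: (yb_ j.+1 (ltn_ord j)).
have -> : riemann_sum c n x xi = \sum_(i < n) \sum_(j < m) l i j *: c (xi i).
  by apply: eq_bigr => i _; rewrite -scaler_suml lx.
have -> : riemann_sum c m y eta = \sum_(i < n) \sum_(j < m) l i j *: c (eta j).
  by rewrite exchange_big; apply: eq_bigr => j _; rewrite -scaler_suml ly.
have -> : (b - a) * e = \sum_(i < n) \sum_(j < m) l i j * e.
  under eq_bigr => i _ do rewrite -mulr_suml lx.
  rewrite -mulr_suml -(big_mkord xpredT (fun i => x i.+1 - x i)).
  by rewrite telescope_sumr// xa xb.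
rewrite -sumrB; apply: (le_trans (ler_norm_sum _ _ _)); apply: ler_sum => i _.
rewrite -sumrB; apply: (le_trans (ler_norm_sum _ _ _)); apply: ler_sum => j _.
rewrite -scalerBr normrZ ger0_norm ?overlap_ge0//.
have [->|l0] := eqVneq (l i j) 0; first by rewrite !mul0r.
rewrite ler_wpM2l ?overlap_ge0//.
have [x1 x2 x3] := xP _ (ltn_ord i); have [y1 y2 y3] := yP _ (ltn_ord j).
have /andP[xa1 _] := xb_ _ (ltnW (ltn_ord i)).
have /andP[_ xb1] := xb_ _ (ltn_ord i).
have /andP[ya1 _] := yb_ _ (ltnW (ltn_ord j)).
have /andP[_ yb1] := yb_ _ (ltn_ord j).
apply: cP; [lra|lra|].
have : 0 < l i j by rewrite lt_neqAle eq_sym l0 overlap_ge0.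
rewrite /l /overlap lt_max ltxx/= subr_gt0 lt_min !gt_max => /andP[/andP[? ?] /andP[? ?]].
by rewrite ltr_norml; lra.
Qed.

(** Integrals with values in [B] are compared through such functionals, which turn their Riemann
    sums into real ones. *)
Definition bounded_functional (phi : B -> R) : Prop :=
  (forall a u v, phi (a *: u + v) = a * phi u + phi v) /\
  exists C : R, forall u, `|phi u| <= C * `|u|.

Section bounded_functional_theory.
Context (phi : B -> R) (bphi : bounded_functional phi).

Lemma bfun0 : phi 0 = 0.
Proof. by have := bphi.1 1 0 0; rewrite scaler0 addr0; lra. Qed.

Lemma bfunZ a u : phi (a *: u) = a * phi u.
Proof. by rewrite -[a *: u]addr0 bphi.1 bfun0 addr0. Qed.

Lemma bfunD u v : phi (u + v) = phi u + phi v.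
Proof. by rewrite -[in LHS](scale1r u) bphi.1 mul1r. Qed.

Lemma bfunB u v : phi (u - v) = phi u - phi v.
Proof. by rewrite -scaleN1r bfunD bfunZ mulN1r. Qed.

Lemma bfun_riemann_sum c n x xi : phi (riemann_sum c n x xi) =
  \sum_(i < n) (x i.+1 - x i) * phi (c (xi i)).
Proof.
rewrite /riemann_sum; elim: n => [|n IH]; first by rewrite !big_ord0 bfun0.
by rewrite !big_ord_recr/= bfunD IH bfunZ.
Qed.

Lemma bfun_continuous : continuous phi.
Proof.
move=> u; have [C CP] := bphi.2.
(* The constant [C] may be zero or negative, so its absolute value plus 1 serves as a positive
   Lipschitz constant. *)
have C1 : 0 < `|C| + 1 by rewrite ltr_pwDr.
apply/cvgrPdist_le => /= e e0; near=> v.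
rewrite -bfunB (le_trans (CP _))//.
rewrite (@le_trans _ _ ((`|C| + 1) * `|u - v|))//.
  by rewrite ler_wpM2r// (le_trans (ler_norm _))// lerDl.
rewrite mulrC -ler_pdivlMr//; near: v.
have := nbhsx_ballx u _ (divr_gt0 e0 C1).
by apply: filterS => v; rewrite -ball_normE => /ltW.
Unshelve. all: by end_near. Qed.

Lemma bfun_integral c a b I : is_integral c a b I ->
  forall e : R, 0 < e -> exists2 delta : R, 0 < delta & forall n x xi,
    tagged_partition a b delta n x xi -> `|phi (riemann_sum c n x xi) - phi I| < e.
Proof.
move=> /is_integralP cI e e0; have [C CP] := bphi.2.
have C1 : 0 < `|C| + 1 by rewrite ltr_pwDr.
have [delta d0 dP] := cI _ (divr_gt0 e0 C1).
exists delta => // n x xi /dP h; rewrite -bfunB (le_lt_trans (CP _))//.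
move: h; rewrite ltr_pdivlMr// mulrC; apply: le_lt_trans.
by rewrite ler_wpM2r// (le_trans (ler_norm _))// lerDl.
Qed.

End bounded_functional_theory.
End riemann_sums.
Arguments riemann_sum {R B}.
Arguments bounded_functional {R B}.

(** Uniform continuity makes the Riemann sums Cauchy as the mesh tends to 0. Completeness gives a
    limit along uniform partitions of mesh below [1 / (k + 1)], and any other fine partition has a
    sum close to one of these. *)
Lemma uniformly_continuous_integral (R : realType) (B : completeNormedModType R)
    (c : R -> B) (a b : R) : a <= b ->
  (forall e : R, 0 < e -> exists2 delta : R, 0 < delta &
     forall s t, a <= s <= b -> a <= t <= b -> `|s - t| < delta ->
       `|c s - c t| <= e) ->
  exists I, is_integral c a b I.
Proof.
move=> ab cP.
(* The [+ 1] keeps the divisor positive when [a = b]. *)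
have ba : 0 < b - a + 1 by rewrite ltr_wpDl ?subr_ge0.
have dist (e : R) : 0 < e -> exists2 delta : R, 0 < delta & forall n x xi m y eta,
    tagged_partition a b delta n x xi -> tagged_partition a b delta m y eta ->
    `|riemann_sum c n x xi - riemann_sum c m y eta| < e.
  move=> e0; have [delta d0 dP] := cP _ (divr_gt0 e0 ba).
  (* Half of [delta], because [riemann_sum_dist] involves the sum of the two meshes. *)
  exists (delta / 2) => [|n x xi m y eta P Q]; first by lra.
  have E0 : 0 < e / (b - a + 1) by rewrite divr_gt0.
  apply: (@le_lt_trans _ _ ((b - a) * (e / (b - a + 1)))).
    apply: (riemann_sum_dist _ _ P Q); first exact: ltW.
    by move=> s t sab tab st; apply: dP => //; lra.
  by rewrite mulrA ltr_pdivrMr// mulrC ltr_pM2l// ltrDl.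
have /choice[P PP] (k : nat) : exists p : nat * (nat -> R) * (nat -> R),
    tagged_partition a b k.+1%:R^-1 p.1.1 p.1.2 p.2.
  have k0 : (0 : R) < k.+1%:R^-1 by rewrite invr_gt0.
  by have [n [x [xi h]]] := uniform_partition ab k0; exists (n, x, xi).
pose S k := riemann_sum c (P k).1.1 (P k).1.2 (P k).2.
have fine (delta : R) : 0 < delta -> \forall k \near \oo,
    tagged_partition a b delta (P k).1.1 (P k).1.2 (P k).2.
  move=> d0; have := near_infty_natSinv_lt (PosNum d0).
  apply: filterS => k /= kd; have [? ? h] := PP k; split => // i /h[? ? ?].
  by split => //; apply: lt_trans kd.
have Scauchy : cauchy (S @ \oo).
  apply: cauchy_exP => e e0; have [delta d0 dP] := dist _ e0.
  near \oo => k; exists (S k); suff : \forall l \near \oo, ball (S k) e (S l) by [].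
  apply: filterS (fine _ d0) => l Pl; rewrite -ball_normE/=; apply: dP => //.
  by near: k; exact: fine.
have /cauchy_cvg/cvg_ex[I SI] := Scauchy.
exists I; apply/is_integralP => e e0; have e2 : 0 < e / 2 by lra.
have [delta d0 dP] := dist _ e2; exists delta => // n x xi Q.
near \oo => k.
rewrite (@le_lt_trans _ _ (`|riemann_sum c n x xi - S k| + `|S k - I|))//.
  by rewrite -[leLHS](congr1 _ (subrKA (S k) _ _)) ler_normD.
rewrite (splitr e) ltrD//.
  by apply: dP => //; near: k; exact: fine.
by near: k; apply: cvgr_distC_lt.
Unshelve. all: by end_near. Qed.

(** Provides a partition of [[a, b']] whose first [n] cells partition [[a, b]], so that sums over
    the two intervals can be compared term by term. *)
Lemma concat_partition (R : realType) (a b b' delta : R) : a <= b -> b <= b' ->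
  0 < delta -> exists n m x xi, tagged_partition a b delta n x xi /\
    tagged_partition a b' delta (n + m) x xi.
Proof.
move=> ab bb' d0.
have [n [x [xi P]]] := uniform_partition ab d0.
have [m [y [eta Q]]] := uniform_partition bb' d0.
have [xa xb xP] := P; have [ya yb yP] := Q.
(* The first half has [n + 1] nodes but only [n] tags, hence the large inequality for the nodes and
   the strict one for the tags; the node of index [n] is shared, since [x n = b = y 0]. *)
pose z i := if (i <= n)%N then x i else y (i - n)%N.
pose zeta i := if (i < n)%N then xi i else eta (i - n)%N.
exists n, m, z, zeta; split; split => //; rewrite /z /zeta ?leqnn//.
- by move=> i ni; rewrite (ltnW ni) ni; exact: xP.
- have [m0|m0] := posnP m; last by rewrite leqNgt -[ltnLHS]addn0 ltn_add2l m0 addKn.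
  by rewrite m0 addn0 leqnn xb -ya -yb m0.
- move=> i inm; move: (inm); case: (ltngtP i n) => [/xP h _|ni _|-> nm].
  + exact: h.
  + rewrite subSn; last exact: ltnW.
    by apply: yP; rewrite ltn_subLR// ltnW.
  + rewrite subnn subSnn xb -ya; apply: yP.
    by move: nm; rewrite -[ltnLHS]addn0 ltn_add2l.
Qed.

(** On a concatenated partition the terms over [[a, b]] are dominated one by one and those over
    [[b, b']] are nonnegative. The curves may take values in different spaces, which allows
    integrals in L^1 to be compared with integrals in L^2. *)
Lemma integral_le (R : realType) (B1 B2 : normedModType R) (c1 : R -> B1)
    (c2 : R -> B2) (phi1 : B1 -> R) (phi2 : B2 -> R) (a b b' : R) I1 I2 :
  bounded_functional phi1 -> bounded_functional phi2 -> a <= b -> b <= b' ->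
  is_integral c1 a b I1 -> is_integral c2 a b' I2 ->
  (forall t, a <= t <= b -> phi1 (c1 t) <= phi2 (c2 t)) ->
  (forall t, b <= t <= b' -> 0 <= phi2 (c2 t)) ->
  phi1 I1 <= phi2 I2.
Proof.
move=> bphi1 bphi2 ab bb' cI1 cI2 c12 c2_ge0.
apply/ler_addgt0Pr => e e0; have e2 : 0 < e / 2 by lra.
have [d1 d1_gt0 P1] := bfun_integral bphi1 cI1 e2.
have [d2 d2_gt0 P2] := bfun_integral bphi2 cI2 e2.
have d0 : 0 < Num.min d1 d2 by rewrite lt_min d1_gt0.
have [n [m [x [xi [Q1 Q2]]]]] := concat_partition ab bb' d0.
have [xa xb xP] := Q1; have [_ xb' xP'] := Q2.
have {P1} := P1 n x xi; have {P2} := P2 (n + m)%N x xi.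
have weaken d k y : Num.min d1 d2 <= d -> tagged_partition a y (Num.min d1 d2) k x xi ->
    tagged_partition a y d k x xi.
  move=> dd [? ? h]; split => // i /h[? ? ?]; split => //; exact: lt_le_trans dd.
move=> /(_ (weaken _ _ _ _ Q2)); rewrite ge_min lexx orbT => /(_ isT) P2.
move=> /(_ (weaken _ _ _ _ Q1)); rewrite ge_min lexx => /(_ isT) P1.
have : phi1 (riemann_sum c1 n x xi) <= phi2 (riemann_sum c2 (n + m) x xi).
  rewrite !bfun_riemann_sum// big_split_ord/= -[leLHS]addr0 lerD//.
    apply: ler_sum => i _; have [h1 h2 _] := xP _ (ltn_ord i).
    rewrite ler_wpM2l ?subr_ge0 ?(le_trans h1)//; apply: c12.
    have /andP[ax _] := partition_bounds Q1 (ltnW (ltn_ord i)).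
    have /andP[_ xb1] := partition_bounds Q1 (ltn_ord i).
    by rewrite (le_trans ax)//= (le_trans h2).
  apply: sumr_ge0 => i _.
  have nim : (n + i < n + m)%N by rewrite ltn_add2l.
  have [h1 h2 _] := xP' _ nim.
  rewrite mulr_ge0 ?subr_ge0 ?(le_trans h1)//; apply: c2_ge0.
  have /andP[_ xb1] := partition_bounds Q2 nim.
  rewrite (le_trans h2)// andbT -xb (le_trans _ h1)//.
  by apply: (partition_le Q2); rewrite leq_addr ltnW.
by move: P1 P2; rewrite !ltr_norml; lra.
Qed.

(** * Almost everywhere calculus in L^1 and L^2 *)

Section Rintegral_ae.
Context {d} {X : measurableType d} {R : realType}.
Variable mu : {measure set X -> \bar R}.
Implicit Types f g : X -> R.

Lemma ae_eq_Rintegral f g : measurable_fun setT f -> measurable_fun setT g ->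
  {ae mu, forall x, f x = g x} -> \int[mu]_x f x = \int[mu]_x g x.
Proof.
move=> mf mg fg; congr fine; apply: ae_eq_integral => //; try exact/measurable_EFinP.
by apply: filterS fg => x /= -> _.
Qed.

Lemma integrable_measurable f : mu.-integrable setT (EFin \o f) ->
  measurable_fun setT f.
Proof. by move=> /measurable_int/measurable_EFinP. Qed.

Lemma ae_le_Rintegral f g : mu.-integrable setT (EFin \o f) ->
  mu.-integrable setT (EFin \o g) -> {ae mu, forall x, f x <= g x} ->
  \int[mu]_x f x <= \int[mu]_x g x.
Proof.
move=> mf mg fg.
have mfr := integrable_measurable mf.
have mgr := integrable_measurable mg.
(* The function [g] is replaced by one that is equal to it almost everywhere and dominates [f] at
   every point. *)
have -> : \int[mu]_x g x = \int[mu]_x (f x + Num.max 0 (g x - f x)).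
  apply: ae_eq_Rintegral => //.
    apply: measurable_funD => //; apply: measurable_maxr => //.
    exact: measurable_funB.
  by apply: filterS fg => x fgx; rewrite max_r ?subr_ge0//; lra.
have mmax : mu.-integrable setT (EFin \o (fun x => Num.max 0 (g x - f x))).
  have := integrableB measurableT mg mf; apply: le_integrable => //=.
    apply/measurable_EFinP; apply: measurable_maxr => //; exact: measurable_funB.
  by move=> x _ /=; rewrite lee_fin; case: (leP 0 (g x - f x)) => h; rewrite ?normr0.
rewrite RintegralD// lerDl; apply: Rintegral_ge0 => x _.
by rewrite le_max lexx.
Qed.

Lemma ae_ge0_Rintegral f : mu.-integrable setT (EFin \o f) ->
  {ae mu, forall x, 0 <= f x} -> 0 <= \int[mu]_x f x.
Proof.
move=> mf f0; have <- : \int[mu]_x (0 : R) = 0 by rewrite Rintegral_cst// mul0r.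
by apply: ae_le_Rintegral => //; rewrite (_ : _ \o _ = cst 0%E)//; exact: integrable0.
Qed.

Lemma ae_le_integrable f g : measurable_fun setT f ->
  mu.-integrable setT (EFin \o g) -> {ae mu, forall x, `|f x| <= g x} ->
  mu.-integrable setT (EFin \o f).
Proof.
move=> mf ig fg; have mg := measurable_int _ ig.
have mfa : measurable_fun setT (fun x => `|(EFin \o f) x|%E).
  by apply: measurableT_comp => //; exact/measurable_EFinP.
have mga : measurable_fun setT (fun x => `|(EFin \o g) x|%E).
  by apply: measurableT_comp.
apply/integrableP; split; first exact/measurable_EFinP.
have /integrableP[_] := ig; apply: le_lt_trans.
apply: ae_ge0_le_integral => //.
by apply: filterS fg => x fgx _ /=; rewrite lee_fin (le_trans fgx)// ler_norm.
Qed.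

End Rintegral_ae.

Section Lspace_ae.
Context {d} {X : measurableType d} {R : realType}.
Context {mu : {measure set X -> \bar R}} {p : \bar R} {p1 : (1 <= p)%E}.
Implicit Types u v : LspaceType mu p1.

Lemma measurable_Lspace u : measurable_fun setT (u : X -> R).
Proof. exact: (measurable_funPT (Lrepr u)). Qed.

Lemma LspaceD u v : {ae mu, forall x, (u + v) x = u x + v x}.
Proof. by apply: filterS (LclassK (Lrepr u + Lrepr v)) => x /(_ I). Qed.

Lemma LspaceZ a u : {ae mu, forall x, (a *: u) x = a * u x}.
Proof. by apply: filterS (LclassK (a *: Lrepr u)) => x /(_ I). Qed.

Lemma LspaceB u v : {ae mu, forall x, (u - v) x = u x - v x}.
Proof.
have := LspaceZ (-1) v; have := LspaceD u (-1 *: v); rewrite scaleN1r.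
by apply: filterS2 => x -> ->; rewrite mulN1r.
Qed.

Lemma Lspace_ex (f : X -> R) : f \in Lfun mu p ->
  exists u : LspaceType mu p1, {ae mu, forall x, u x = f x}.
Proof.
move=> fp; exists (Lclass (Lfun_Sub p1 fp)).
by apply: filterS (LclassK (Lfun_Sub p1 fp)) => x /(_ I).
Qed.

End Lspace_ae.

Section L1_theory.
Context {d} {X : measurableType d} {R : realType}.
Context {mu : {measure set X -> \bar R}}.
Implicit Types u v : L1 mu.

Lemma L1_integrable u : mu.-integrable setT (EFin \o u).
Proof. by apply/Lfun1_integrable; exact: Lspace_repr_subproof. Qed.

Lemma L1_integrable_norm u : mu.-integrable setT (EFin \o (fun x => `|u x|)).
Proof. exact: (integrable_norm (L1_integrable u)). Qed.

Lemma L1_ex (f : X -> R) : mu.-integrable setT (EFin \o f) ->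
  exists u : L1 mu, {ae mu, forall x, u x = f x}.
Proof. by move=> /Lfun1_integrable/Lspace_ex. Qed.

Lemma L1_norm u : `|u| = \int[mu]_x `|u x|.
Proof. by rewrite -[LHS]/(Lspace_norm u) /Lspace_norm Lnorm1. Qed.

Lemma L1_norm_le u (f : X -> R) : mu.-integrable setT (EFin \o f) ->
  {ae mu, forall x, `|u x| <= f x} -> `|u| <= \int[mu]_x f x.
Proof. by move=> fi uf; rewrite L1_norm ae_le_Rintegral// L1_integrable_norm. Qed.

Lemma L1_integrableM u (k : X -> R) : measurable_fun setT k ->
  {ae mu, forall x, `|k x| <= 1} -> mu.-integrable setT (EFin \o (fun x => u x * k x)).
Proof.
move=> mk k1; apply: (ae_le_integrable (measurable_funM (measurable_Lspace u) mk)).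
  exact: L1_integrable_norm.
by apply: filterS k1 => x kx /=; rewrite normrM ler_piMr.
Qed.

Lemma L1_bounded_functional (k : X -> R) : measurable_fun setT k ->
  {ae mu, forall x, `|k x| <= 1} ->
  bounded_functional (fun u : L1 mu => \int[mu]_x (u x * k x)).
Proof.
move=> mk k1; have iM u := L1_integrableM u mk k1; split=> [a u v|].
  rewrite -RintegralZl// -RintegralD//; last first.
    by have := integrableZl measurableT a (iM u).
  apply: ae_eq_Rintegral => //.
  - exact: (integrable_measurable (iM _)).
  - apply: measurable_funD.
      apply: measurable_funM => //; exact: (integrable_measurable (iM _)).
    exact: (integrable_measurable (iM _)).
  - have := LspaceZ a u; apply: filterS2 (LspaceD (a *: u) v) => x -> ->.
    by rewrite mulrDl mulrA.
exists 1 => u; rewrite mul1r L1_norm.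
apply: (le_trans (le_normr_Rintegral measurableT (iM u))).
apply: ae_le_Rintegral; [exact: integrable_norm|exact: L1_integrable_norm|].
by apply: filterS k1 => x kx; rewrite normrM ler_piMr.
Qed.

(* Tests against the indicator of [u < 0]. *)
Lemma L1_ge0P u : (forall k : X -> R, measurable_fun setT k ->
    (forall x, 0 <= k x <= 1) -> 0 <= \int[mu]_x (u x * k x)) ->
  {ae mu, forall x, 0 <= u x}.
Proof.
move=> uP; pose k x : R := (u x < 0)%R%:R.
have mk : measurable_fun setT k.
  rewrite (_ : k = \1_[set x | u x < 0]).
    apply: measurable_indic; rewrite -[X in measurable X]setTI.
    rewrite (_ : [set x | _] = (u : X -> R) @^-1` `]-oo, 0[%classic).
      exact: measurable_Lspace.
    by apply/seteqP; split => x /=; rewrite in_itv.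
  by apply/funext => x; rewrite /k indicE; congr (nat_of_bool _)%:R; apply/idP/idP;
    rewrite inE.
have k01 x : 0 <= k x <= 1 by rewrite /k; case: (u x < 0); rewrite ?lexx ?ler01.
have k1 : {ae mu, forall x, `|k x| <= 1}.
  by apply: aeW => x; have /andP[? ?] := k01 x; rewrite ger0_norm.
have iM := L1_integrableM u mk k1.
(* As [u * k] is nowhere positive, the nonnegativity of its integral forces the integral of its
   absolute value to vanish. *)
have ukE x : `|u x * k x| = - (u x * k x).
  rewrite /k; case: ltP => h; rewrite ?mulr1 ?mulr0 ?normr0 ?oppr0//.
  by rewrite ltr0_norm.
have int0 : (\int[mu]_x `|(u x * k x)%:E| = 0)%E.
  have -> : (\int[mu]_x `|(u x * k x)%:E| = (\int[mu]_x `|u x * k x|)%:E)%E.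
    by rewrite /Rintegral fineK//; apply: integrable_fin_num => //; exact: integrable_norm.
  congr EFin; under eq_Rintegral => x _ do rewrite ukE -mulN1r.
  rewrite RintegralZl// mulN1r; apply/eqP; rewrite oppr_eq0 eq_le uP// andbT.
  have : 0 <= \int[mu]_x `|u x * k x| by apply: Rintegral_ge0.
  under eq_Rintegral => x _ do rewrite ukE -mulN1r.
  by rewrite RintegralZl// mulN1r oppr_ge0.
have /ae_eq_integral_abs := measurable_int _ iM.
move=> /(_ mu measurableT)[/(_ int0) + _]; apply: filterS => x /(_ I)/= [].
by rewrite /k; case: ltP => // h; rewrite mulr1 => /eqP; rewrite lt_eqF.
Qed.

End L1_theory.

Section L2_theory.
Context {d} {X : measurableType d} {R : realType}.
Context {mu : {measure set X -> \bar R}}.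
Implicit Types u v : L2 mu.

Lemma L2_integrableM u v : mu.-integrable setT (EFin \o (fun x => u x * v x)).
Proof. by apply/Lfun1_integrable/Lfun2_mul_Lfun1; exact: Lspace_repr_subproof. Qed.

Lemma measurable_L2M u v : measurable_fun setT (fun x => u x * v x).
Proof. by apply: measurable_funM; exact: measurable_Lspace. Qed.

Lemma Lfun2_sqr (f : X -> R) : measurable_fun setT f ->
  mu.-integrable setT (EFin \o (fun x => f x ^+ 2)) -> f \in Lfun mu 2%:E.
Proof.
move=> mf /integrableP[_ if2]; apply/andP; split; rewrite inE//=.
rewrite /finite_norm unlock poweR_lty//; apply: le_lt_trans if2.
apply: ge0_le_integral => //.
- by move=> x _; exact: poweR_ge0.
- apply: (measurableT_comp (measurable_poweR _)) => //.
  by apply: measurableT_comp => //; exact/measurable_EFinP.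
- apply: measurableT_comp => //; apply/measurable_EFinP; exact: measurable_funX.
- by move=> x _ /=; rewrite lee_fin normrX powR_mulrn.
Qed.

Lemma dotC u v : dot u v = dot v u.
Proof. by apply: eq_Rintegral => x _; rewrite mulrC. Qed.

Lemma dot_linear v a u w : dot (a *: u + w) v = a * dot u v + dot w v.
Proof.
rewrite /dot -RintegralZl ?L2_integrableM//.
rewrite -RintegralD ?L2_integrableM//; last first.
  by have := integrableZl measurableT a (L2_integrableM u v).
apply: ae_eq_Rintegral; first exact: measurable_L2M.
- apply: measurable_funD; last exact: measurable_L2M.
  by apply: measurable_funM => //; exact: measurable_L2M.
- have := LspaceZ a u; apply: filterS2 (LspaceD (a *: u) w) => x -> ->.
  by rewrite mulrDl mulrA.
Qed.

Lemma L2_norm u : `|u| ^+ 2 = dot u u.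
Proof.
have h : `|u|%:E = 'N[mu]_2[EFin \o u]%E by exact: finite_norm_fine.
apply: EFin_inj; rewrite /dot /Rintegral fineK; last first.
  exact: (integrable_fin_num measurableT (L2_integrableM u u)).
rewrite -powR_mulrn// -poweR_EFin h powR_Lnorm//.
by apply: eq_integral => x _ /=; rewrite powR_mulrn// real_normK ?num_real.
Qed.

Lemma dot_ge0 u v : {ae mu, forall x, 0 <= u x} -> {ae mu, forall x, 0 <= v x} ->
  0 <= dot u v.
Proof.
move=> u0 v0; apply: ae_ge0_Rintegral; first exact: L2_integrableM.
by apply: filterS2 u0 v0 => x; exact: mulr_ge0.
Qed.

Lemma hoelder_L2 u v : \int[mu]_x `|u x * v x| <= `|u| * `|v|.
Proof.
have hu : `|u|%:E = 'N[mu]_2[EFin \o u]%E by exact: finite_norm_fine.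
have hv : `|v|%:E = 'N[mu]_2[EFin \o v]%E by exact: finite_norm_fine.
rewrite -lee_fin EFinM hu hv.
have := @hoelder _ _ _ mu u v 2 2 (measurable_Lspace u) (measurable_Lspace v).
rewrite Lnorm1 /Rintegral fineK; last first.
  by apply: integrable_fin_num => //; exact: integrable_norm (L2_integrableM u v).
by apply => //; rewrite [RHS]splitr !div1r.
Qed.

Lemma CauchySchwarz_dot u v : `|dot u v| <= `|u| * `|v|.
Proof.
apply: le_trans (hoelder_L2 u v).
exact: (le_normr_Rintegral measurableT (L2_integrableM u v)).
Qed.

Lemma dot_bounded_functional v : bounded_functional (fun u => dot u v).
Proof.
by split=> [a u w|]; [exact: dot_linear|exists `|v| => u; rewrite mulrC CauchySchwarz_dot].
Qed.

End L2_theory.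

(** * Completeness of L^1 *)

Section L1_complete.
Context {d} {X : measurableType d} {R : realType}.
Context {mu : {measure set X -> \bar R}}.

(** The Riesz-Fischer argument: the increments have summable norms, so the sum [S] of their absolute
    values is integrable and the telescoping series converges absolutely almost everywhere.
    Dominated convergence with majorant [g], the sum of [|u 0|] and [S], gives convergence in
    norm. *)
Lemma L1_fast_cauchy_cvg (u : nat -> L1 mu) :
  (forall n, `|u n.+1 - u n| <= (2 ^ n.+1)%:R^-1) ->
  exists v : L1 mu, `|u n - v| @[n --> \oo] --> 0.
Proof.
move=> uP; pose w n : L1 mu := u n.+1 - u n.
pose S x := (\sum_(n <oo) (`|w n x|)%:E)%E.
have mw n : measurable_fun setT (fun x => (`|w n x|)%:E).
  exact: measurable_int (L1_integrable_norm (w n)).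
have mS : measurable_fun setT S.
  by apply: ge0_emeasurable_sum => // n x _ _; rewrite lee_fin.
have S0 x : (0 <= S x)%E by apply: nneseries_ge0 => n _ _; rewrite lee_fin.
have wE n : (\int[mu]_x (`|w n x|)%:E = (`|w n|)%:E)%E.
  rewrite L1_norm /Rintegral fineK//.
  exact: (integrable_fin_num measurableT (L1_integrable_norm (w n))).
have iS : mu.-integrable setT S.
  apply/integrableP; split => //.
  under eq_integral => x _ do rewrite gee0_abs//.
  rewrite integral_nneseries//.
  under eq_eseriesr => n _ do rewrite wE.
  have half : (\sum_(n <oo) (1 / (2 ^ (n + 1))%:R)%:E)%E = 1%:E :> \bar R.
    by have := @cvg_geometric_eseries_half R 1 0; rewrite expr0 divr1 => /(cvg_lim _) <-.
  apply: (@le_lt_trans _ _ (\sum_(n <oo) (1 / (2 ^ (n + 1))%:R)%:E)%E).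
    apply: lee_nneseries => n _; first by rewrite lee_fin.
    by rewrite lee_fin addn1 div1r uP.
  by rewrite half ltry.
pose u0 x : R := `|u 0%N x|; pose g x := ((u0 x)%:E + S x)%E.
have ig : mu.-integrable setT g.
  exact: (integrableD measurableT (L1_integrable_norm (u 0%N)) iS).
(* A limit superior is measurable without any convergence assumption; almost everywhere it is the
   limit of [u n x]. *)
pose f x := fine (limn_esup (fun n => (u n x)%:E)).
have mu_ n : measurable_fun setT (EFin \o u n : X -> \bar R).
  by apply/measurable_EFinP; exact: measurable_Lspace.
have mf : measurable_fun setT f.
  by apply: measurableT_comp => //; exact: measurable_fun_limn_esup.
have wu : {ae mu, forall x, forall n, w n x = u n.+1 x - u n x}.
  by apply: ae_foralln => n; exact: LspaceB.
have Sfin : {ae mu, forall x, S x \is a fin_num}.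
  by apply: filterS (integrable_ae measurableT iS) => x /(_ I).
have main : {ae mu, forall x,
    (u n x)%:E @[n --> \oo] --> (f x)%:E /\ forall n, (`|(u n x)%:E| <= g x)%E}.
  apply: filterS2 wu Sfin => x wx Sx.
  have bnd n : series (fun k => `|w k x|) n <= fine (S x).
    rewrite -lee_fin fineK// /series/= -sumEFin.
    by apply: (@nneseries_lim_ge _ _ xpredT) => k _; rewrite lee_fin.
  have tele n : series (fun k => w k x) n = u n x - u 0%N x.
    rewrite /series/=; under eq_bigr => k _ do rewrite wx.
    by rewrite telescope_sumr.
  split=> [|n]; last first.
    rewrite /g/= -(fineK Sx) -EFinD lee_fin.
    have -> : u n x = u 0%N x + series (fun k => w k x) n by rewrite tele addrC subrK.
    rewrite (le_trans (ler_normD _ _))// lerD2l (le_trans _ (bnd n))//.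
    exact: ler_norm_sum.
  have /normed_cvg/cvg_ex[/= l wl] : cvgn [normed series (fun k => w k x : R^o)].
    apply: nondecreasing_is_cvgn.
      by apply/nondecreasing_seqP => n; rewrite [leRHS]/= seriesSr lerDl.
    by exists (fine (S x)) => _ [n _ <-]; exact: bnd.
  have ul : (u n x)%:E @[n --> \oo] --> (u 0%N x + l)%:E.
    apply: cvg_EFin; first exact: nearW.
    rewrite [X in X @ _ --> _](_ : _ = (fun n => u 0%N x + series (fun k => w k x) n)).
      by apply: cvgD => //; exact: cvg_cst.
    by apply/funext => n; rewrite /= tele addrC subrK.
  suff -> : f x = u 0%N x + l by [].
  rewrite /f is_cvg_limn_esupE; last by apply/cvg_ex; exists (u 0%N x + l)%:E.
  by rewrite (cvg_lim _ ul).
have [] := @dominated_convergence _ _ _ mu setT measurableT (fun n => EFin \o u n)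
  (EFin \o f) g mu_ _ _ ig.
- exact/measurable_EFinP.
- by apply: filterS main => x [ux _] _.
- by apply: filterS main => x [_ ux] n _; exact: ux.
move=> /L1_ex[v vf] int0 _; exists v.
have /fine_cvgP[_] := int0.
rewrite [X in X @ _ --> _](_ : _ = (fun n => `|u n - v|))//.
apply/funext => n /=; rewrite L1_norm /Rintegral; congr fine; apply/esym.
apply: ae_eq_integral => //.
- exact: measurable_int (L1_integrable_norm _).
- apply/measurable_EFinP; apply: measurableT_comp => //.
  by apply: measurable_funB => //; exact: measurable_Lspace.
- by apply: filterS2 vf (LspaceB (u n) v) => x /= vx -> _; rewrite vx.
Qed.

(** A Cauchy filter contains balls of radius [(2 ^ k.+2)%:R^-1]. Consecutive ones meet, so their
    centres form a fast Cauchy sequence, and the filter converges to its limit. *)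
Lemma L1_complete (F : set_system (L1 mu)) : ProperFilter F -> cauchy F -> cvg F.
Proof.
move=> FF /cauchyP Fc.
have r0 (k : nat) : 0 < (2 ^ k.+2)%:R^-1 :> R by rewrite invr_gt0 ltr0n expn_gt0.
have /choice[y yP] (k : nat) : exists z, F (ball z (2 ^ k.+2)%:R^-1) by exact: Fc.
have [n|v yv] := L1_fast_cauchy_cvg (u := y).
  have [z [zn zn1]] := filter_ex (filterI (yP n) (yP n.+1)).
  move: zn zn1; rewrite -!ball_normE/= => zn zn1.
  have -> : y n.+1 - y n = (y n.+1 - z) - (y n - z) by rewrite opprB addrA subrK.
  rewrite (le_trans (ler_normB _ _))//.
  have h1 : (2 ^ n.+3)%:R^-1 = (2 ^ n.+1)%:R^-1 / 4 :> R.
    by rewrite (expnSr 2 n.+2) (expnSr 2 n.+1) !natrM !invfM; lra.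
  have h2 : (2 ^ n.+2)%:R^-1 = (2 ^ n.+1)%:R^-1 / 2 :> R.
    by rewrite (expnSr 2 n.+1) natrM invfM.
  have : 0 < (2 ^ n.+1)%:R^-1 :> R by rewrite invr_gt0 ltr0n expn_gt0.
  by move: zn zn1; rewrite h1 h2; lra.
apply/cvg_ex; exists v; apply/cvgrPdist_lt => e e0.
have e2 : 0 < e / 2 by lra.
near \oo => k.
suff : F (ball (y k) (2 ^ k.+2)%:R^-1).
  apply: filterS => z; rewrite -ball_normE/= => yz.
  have -> : v - z = - (y k - v) + (y k - z) by rewrite opprB addrA subrK.
  rewrite (le_lt_trans (ler_normD _ _))// normrN (splitr e) ltrD//.
    near: k; move/cvgrPdist_lt : yv => /(_ _ e2); apply: filterS => k.
    by rewrite sub0r normrN normr_id.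
  apply: (lt_trans yz); apply: (@le_lt_trans _ _ k.+1%:R^-1).
    rewrite lef_pV2 ?posrE ?ltr0n ?expn_gt0// ler_nat.
    by rewrite ltnW// (leq_trans (ltn_expl k.+1 (leqnn 2)))// leq_exp2l.
  by near: k; exact: (near_infty_natSinv_lt (PosNum e2)).
exact: yP.
Unshelve. all: by end_near. Qed.

HB.instance Definition _ := Pointed.on (L1 mu).
HB.instance Definition _ := Uniform_isComplete.Build (L1 mu) L1_complete.

End L1_complete.

(** * Semigroups on L^1 *)

Lemma at_right0P (R : realType) (P : R -> Prop) : (\forall t \near 0^'+, P t) ->
  exists2 delta : R, 0 < delta & forall t, 0 < t < delta -> P t.
Proof.
move=> /nbhs_ballP[delta /= d0 dP]; exists delta => // t /andP[t0 td].
by apply: dP => //; rewrite -ball_normE/= sub0r normrN gtr0_norm.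
Qed.

(** For [s <= t], [T t g - T s g] is the image of [T (t - s) g - g] under the contraction [T s];
    continuity at 0 therefore yields a modulus valid at all times. *)
Lemma contraction_semigroup_uniform_continuity (R : realType) (B : normedModType R)
    (T : R -> {linear B -> B}) (g : B) :
  (forall s t f, 0 <= s -> 0 <= t -> T (s + t) f = T s (T t f)) ->
  (forall t f, 0 <= t -> `|T t f| <= `|f|) ->
  (forall e : R, 0 < e -> exists2 delta : R, 0 < delta &
     forall t, 0 <= t < delta -> `|T t g - g| <= e) ->
  forall e : R, 0 < e -> exists2 delta : R, 0 < delta &
    forall s t, 0 <= s -> 0 <= t -> `|s - t| < delta -> `|T s g - T t g| <= e.
Proof.
move=> TD Tle T0 e /T0[delta d0 dP]; exists delta => //.
have main s t : 0 <= s -> s <= t -> t - s < delta -> `|T t g - T s g| <= e.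
  move=> s0 st std; have ts : 0 <= t - s by rewrite subr_ge0.
  rewrite -(subrK s t) [t - s + s]addrC TD// -linearB.
  by rewrite (le_trans (Tle _ _ _))// dP// ts.
move=> s t s0 t0; have [st|/ltW ts] := leP s t.
  by rewrite ler0_norm ?subr_le0// opprB distrC; exact: main.
by rewrite ger0_norm ?subr_ge0//; exact: main.
Qed.

Section L1_semigroup.
Context {d} {X : measurableType d} {R : realType}.
Context {mu : {measure set X -> \bar R}}.
Variables (T : R -> {linear L2 mu -> L2 mu}) (T1 : R -> {linear L1 mu -> L1 mu}).
Hypothesis T1_T : L1_extension T T1.

Lemma L1_extension_ae (t : R) (f1 : L1 mu) (f2 : L2 mu) : 0 <= t ->
  {ae mu, forall x, f1 x = f2 x} -> {ae mu, forall x, T1 t f1 x = T t f2 x}.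
Proof.
move=> t0 f12; have : (f1 : X -> R) = f2 %[ae mu] by apply: filterS f12 => x.
by move=> /(L1_extends T1_T t0); apply: filterS => x /(_ I).
Qed.

Lemma L1_extension_le (t : R) (f g : L1 mu) : 0 <= t ->
  {ae mu, forall x, f x <= g x} -> {ae mu, forall x, T1 t f x <= T1 t g x}.
Proof.
move=> t0 fg; have : {ae mu, forall x, 0 <= (g - f) x}.
  by apply: filterS2 fg (LspaceB g f) => x fgx ->; rewrite subr_ge0.
move=> /(L1_positivity T1_T t0); rewrite linearB.
by apply: filterS2 (LspaceB (T1 t g) (T1 t f)) => x ->; rewrite subr_ge0.
Qed.

Hypothesis T_C0 : C0_contraction_semigroup T.

(* With [D := T t g2 - g2], positivity and contractivity in L^1 bound
   [|T1 t g1 - g1|] by twice the integral of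
   [min g1 |D| <= e * p + p * |D| / e]. *)
Lemma L1_extension_continuous_sqr (p1 g1 : L1 mu) (p2 g2 : L2 mu) :
  {ae mu, forall x, [/\ 0 <= p1 x, p2 x = p1 x, g1 x = p1 x ^+ 2 & g2 x = g1 x]} ->
  forall e : R, 0 < e -> exists2 delta : R, 0 < delta &
    forall t, 0 <= t < delta -> `|T1 t g1 - g1| <= e.
Proof.
move=> pg e e0; have [T0 TD Tle Tcvg] := T_C0.
have bound t eta : 0 <= t -> 0 < eta ->
    `|T1 t g1 - g1| <= 2 * (eta * `|p1| + eta^-1 * (`|p2| * `|T t g2 - g2|)).
  move=> t0 eta0; set D := T t g2 - g2.
  have i1 := integrableZl measurableT eta (L1_integrable p1).
  have i2 := integrableZl measurableT eta^-1 (integrable_norm (L2_integrableM p2 D)).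
  have i12 := integrableZl measurableT 2 (integrableD measurableT i1 i2).
  have i3 := integrableB measurableT (L1_integrable (T1 t g1)) (L1_integrable g1).
  have i4 := integrableD measurableT i12 i3.
  have g1_ge0 : {ae mu, forall x, 0 <= g1 x}.
    by apply: filterS pg => x [? ? -> _]; exact: sqr_ge0.
  have Tg1_ge0 := L1_positivity T1_T t0 g1_ge0.
  have norm_ge0 (u : L1 mu) : {ae mu, forall x, 0 <= u x} -> `|u| = \int[mu]_x u x.
    move=> u0; rewrite L1_norm; apply: ae_eq_Rintegral.
    - exact: (integrable_measurable (L1_integrable_norm u)).
    - exact: measurable_Lspace.
    - by apply: filterS u0 => x /ger0_norm.
  (* The absolute value of [D] is [D] plus twice its negative part. The negative part is bounded by
     the term in parentheses after the factor 2, while [D] has integral at most 0 by contractivity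
     in L^1. *)
  apply: (@le_trans _ _ (\int[mu]_x (2 * (eta * p1 x + eta^-1 * `|p2 x * D x|) +
      (T1 t g1 x - g1 x)))).
    apply: L1_norm_le; first exact: i4.
    have Tg : {ae mu, forall x, T1 t g1 x = T t g2 x}.
      by apply: L1_extension_ae => //; apply: filterS pg => x [].
    have DE : {ae mu, forall x, D x = T1 t g1 x - g1 x}.
      apply: filterS3 Tg pg (LspaceB (T t g2) g2) => x Tgx [_ _ _ g21] ->.
      by rewrite Tgx g21.
    have pTg : {ae mu, forall x, [/\ 0 <= p1 x, p2 x = p1 x, g1 x = p1 x ^+ 2 &
        0 <= T1 t g1 x]} by apply: filterS2 pg Tg1_ge0 => x [].
    apply: filterS3 DE (LspaceB (T1 t g1) g1) pTg => x Dx -> [p0 p21 g1p Tg0].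
    rewrite -Dx p21 normrM (ger0_norm p0).
    have eta1 : 0 < eta^-1 by rewrite invr_gt0.
    have [D0|D0] := leP 0 (D x).
      by rewrite ger0_norm// addrC lerDl !mulr_ge0// addr_ge0 ?mulr_ge0// ltW.
    rewrite (ltr0_norm D0).
    have pD : 0 <= eta^-1 * (p1 x * - D x).
      by apply: mulr_ge0; [exact: ltW|apply: mulr_ge0 => //; lra].
    (* Positivity gives [- D x <= p1 x ^+ 2], which is at most [eta * p1 x] where [p1 x <= eta].
       Elsewhere [p1 x / eta] exceeds 1 and multiplying [- D x] by it only enlarges it. *)
    have [pe|pe] := leP (p1 x) eta.
      have : p1 x ^+ 2 <= eta * p1 x by rewrite expr2 ler_wpM2r.
      have Dp : - D x <= p1 x ^+ 2 by move: Tg0; lra.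
      lra.
    have : - D x <= eta^-1 * (p1 x * - D x).
      rewrite mulrA ler_peMl//; first lra.
      by rewrite mulrC ler_pdivlMr// mul1r ltW.
    have : 0 <= eta * p1 x by rewrite mulr_ge0// ltW.
    lra.
  have norm2 := integrable_norm (L2_integrableM p2 D).
  rewrite (RintegralD measurableT i12 i3).
  rewrite (RintegralB measurableT (L1_integrable (T1 t g1)) (L1_integrable g1)).
  rewrite (RintegralZl 2 measurableT (integrableD measurableT i1 i2)).
  rewrite (RintegralD measurableT i1 i2).
  rewrite (RintegralZl eta measurableT (L1_integrable p1)).
  rewrite (RintegralZl eta^-1 measurableT norm2).
  rewrite -(norm_ge0 _ g1_ge0) -(norm_ge0 _ Tg1_ge0).
  rewrite -norm_ge0; last by apply: filterS pg => x [].
  have := L1_contraction T1_T g1 t0.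
  have : eta^-1 * \int[mu]_x `|p2 x * D x| <= eta^-1 * (`|p2| * `|D|).
    by rewrite ler_wpM2l ?hoelder_L2// invr_ge0 ltW.
  lra.
(* With this [eta], and the matching bound [e1] on the L^2 increment, each of the two summands in
   [bound] is at most [e / 4]. *)
pose eta := e / (4 * (`|p1| + 1)).
have p1_gt0 : 0 < `|p1| + 1 by rewrite ltr_wpDl.
have p2_gt0 : 0 < `|p2| + 1 by rewrite ltr_wpDl.
have eta0 : 0 < eta by rewrite divr_gt0// mulr_gt0.
have e1 : 0 < eta * e / (4 * (`|p2| + 1)) by rewrite divr_gt0 ?mulr_gt0.
have /cvgrPdist_lt/(_ _ e1)/at_right0P[delta d0 dP] := Tcvg g2.
exists delta => // t /andP[t0 td].
have Dt : `|T t g2 - g2| <= eta * e / (4 * (`|p2| + 1)).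
  (* The one-sided limit excludes [t = 0], where [T 0] is the identity. *)
  have [->|t_neq0] := eqVneq t 0; first by rewrite T0 subrr normr0 ltW.
  by rewrite distrC ltW// dP// lt_neqAle eq_sym t_neq0 t0.
apply: (le_trans (bound t eta t0 eta0)).
have h1 : eta * `|p1| <= e / 4.
  have -> : e / 4 = eta * (`|p1| + 1) by rewrite /eta; field; rewrite gt_eqF.
  by rewrite ler_wpM2l ?lerDl// ltW.
have h2 : eta^-1 * (`|p2| * `|T t g2 - g2|) <= e / 4.
  have -> : e / 4 = eta^-1 * ((`|p2| + 1) * (eta * e / (4 * (`|p2| + 1)))).
    by field; rewrite !gt_eqF.
  rewrite ler_wpM2l ?invr_ge0 ?ler_pM// ?lerDl// ltW//.
lra.
Qed.

(** The orbit of [g1] is uniformly continuous in L^1, because [g1] is the square of a nonnegative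
    function lying in both L^1 and L^2, and [L1 mu] is complete. *)
Lemma L1_extension_integral_ex (p1 g1 : L1 mu) (p2 g2 : L2 mu) (b : R) : 0 <= b ->
  {ae mu, forall x, [/\ 0 <= p1 x, p2 x = p1 x, g1 x = p1 x ^+ 2 & g2 x = g1 x]} ->
  exists I, is_integral (fun t => T1 t g1) 0 b I.
Proof.
move=> b0 pg; apply: uniformly_continuous_integral => // e e0.
have [delta d0 dP] := contraction_semigroup_uniform_continuity
  (L1_semigroup T1_T) (L1_contraction T1_T) (L1_extension_continuous_sqr pg) e0.
by exists delta => // s t /andP[s0 _] /andP[t0 _]; exact: dP.
Qed.

(** The integrals are defined by norm convergence, so their pointwise order is recovered by testing
    against measurable [k] with values in [[0, 1]], where [integral_le] applies. *)
Lemma L1_potential_nondecreasing (h : L1 mu) (I : nat -> L1 mu) :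
  {ae mu, forall x, 0 <= h x} ->
  (forall N : nat, is_integral (fun t => T1 t h) 0 N%:R (I N)) ->
  {ae mu, forall x, forall N, 0 <= I N x <= I N.+1 x}.
Proof.
move=> h0 hI.
have pos (k : X -> R) t : measurable_fun setT k -> (forall x, 0 <= k x <= 1) ->
    0 <= t -> 0 <= \int[mu]_x (T1 t h x * k x).
  move=> mk k01 t0; apply: ae_ge0_Rintegral.
    apply: L1_integrableM => //; apply: aeW => x.
    by have /andP[? ?] := k01 x; rewrite ger0_norm.
  have := L1_positivity T1_T t0 h0; apply: filterS => x ?.
  by rewrite mulr_ge0//; case/andP : (k01 x).
have bfun (k : X -> R) : measurable_fun setT k -> (forall x, 0 <= k x <= 1) ->
    bounded_functional (fun u : L1 mu => \int[mu]_x (u x * k x)).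
  move=> mk k01; apply: L1_bounded_functional => //; apply: aeW => x.
  by have /andP[? ?] := k01 x; rewrite ger0_norm.
have I_ge0 N : {ae mu, forall x, 0 <= I N x}.
  apply: L1_ge0P => k mk k01.
  (* Comparison with the zero functional on the same interval, so that the tail interval is reduced
     to a point. *)
  apply: (@integral_le R _ _ _ _ (fun=> 0) _ 0 N%:R N%:R _ _ _ (bfun k mk k01)
    _ _ (hI N) (hI N)) => //.
  - by split=> [a u v|]; [rewrite mulr0 addr0|exists 0 => u; rewrite normr0 mul0r].
  - by move=> t /andP[t0 _]; exact: pos.
  - by move=> t /andP[Nt _]; apply: pos => //; exact: le_trans Nt.
have I_nd N : {ae mu, forall x, 0 <= (I N.+1 - I N) x}.
  apply: L1_ge0P => k mk k01; have bk := bfun k mk k01.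
  rewrite (bfunB bk) subr_ge0.
  apply: (@integral_le R _ _ _ _ _ _ 0 N%:R N.+1%:R _ _ bk bk _ _ (hI N) (hI N.+1)) => //.
  - by rewrite ler_nat.
  - by move=> t /andP[Nt _]; apply: pos => //; exact: le_trans Nt.
have := ae_foralln I_ge0; have := ae_foralln I_nd.
have := ae_foralln (fun N => LspaceB (I N.+1) (I N)).
apply: filterS3 => x IB I1 I0 N; rewrite I0/= -subr_ge0 -IB; exact: I1.
Qed.

(** For [t >= 0], the inequalities [0 <= p1 <= h] and [expR (- (a * t)) <= 1] bound the integrand of
    the resolvent, tested against [p2], by that of the potential of [h]. The bound [M] on each
    [[0, N]] then passes to the limit. *)
Lemma resolvent_potential_le (G : R -> {linear L2 mu -> L2 mu}) (h p1 : L1 mu)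
    (p2 : L2 mu) (I : nat -> L1 mu) (M : R) : semigroup_resolvent T G ->
  {ae mu, forall x, [/\ 0 <= p1 x, p1 x <= 1, p1 x <= h x & p2 x = p1 x]} ->
  (forall N : nat, is_integral (fun t => T1 t h) 0 N%:R (I N)) ->
  (forall N, \int[mu]_x (I N x * p2 x) <= M) ->
  forall a, 0 < a -> dot (G a p2) p2 <= M.
Proof.
move=> TG ph hI IM a a0; have [J [cJ Jcvg]] := TG a p2 a0.
have p2_ge0 : {ae mu, forall x, 0 <= p2 x} by apply: filterS ph => x [? _ _ ->].
have bp1 : bounded_functional (fun u : L1 mu => \int[mu]_x (u x * p2 x)).
  apply: L1_bounded_functional; first exact: measurable_Lspace.
  by apply: filterS ph => x [p0 ple1 _ ->]; rewrite ger0_norm.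
have iM (u : L1 mu) : mu.-integrable setT (EFin \o (fun x => u x * p2 x)).
  apply: L1_integrableM; first exact: measurable_Lspace.
  by apply: filterS ph => x [p0 ple1 _ ->]; rewrite ger0_norm.
have Tp t : 0 <= t -> {ae mu, forall x, 0 <= T t p2 x <= T1 t h x}.
  move=> t0; have p12 : {ae mu, forall x, p1 x = p2 x} by apply: filterS ph => x [].
  have p10 : {ae mu, forall x, 0 <= p1 x} by apply: filterS ph => x [].
  have p1h : {ae mu, forall x, p1 x <= h x} by apply: filterS ph => x [].
  apply: filterS3 (L1_extension_ae t0 p12) (L1_positivity T1_T t0 p10)
    (L1_extension_le t0 p1h) => x -> -> //.
have TI t : 0 <= t ->
    dot (expR (- (a * t)) *: T t p2) p2 <= \int[mu]_x (T1 t h x * p2 x).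
  move=> t0; rewrite (bfunZ (dot_bounded_functional p2)).
  have Tp0 : 0 <= dot (T t p2) p2.
    by apply: dot_ge0 => //; apply: filterS (Tp t t0) => x /andP[].
  apply: (@le_trans _ _ (dot (T t p2) p2)).
    by rewrite ler_piMl// -expR0 ler_expR oppr_le0 mulr_ge0// ltW.
  apply: ae_le_Rintegral => //; first exact: L2_integrableM.
  by apply: filterS2 p2_ge0 (Tp t t0) => x p0 /andP[_ h1]; exact: ler_wpM2r.
have JM (N : nat) : dot (J N%:R) p2 <= M.
  apply: le_trans (IM N); have N0 : 0 <= N%:R :> R by [].
  apply: (integral_le (dot_bounded_functional p2) bp1 N0 (lexx _) (cJ _ N0) (hI N)).
    by move=> t /andP[t0 _]; exact: TI.
  move=> t /andP[Nt _]; have t0 := le_trans N0 Nt.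
  apply: ae_ge0_Rintegral => //; apply: filterS2 p2_ge0 (Tp t t0) => x ? /andP[h1 h2].
  by rewrite mulr_ge0// (le_trans h1).
have cvgJ : dot (J N%:R) p2 @[N --> \oo] --> dot (G a p2) p2.
  have bcont := @bfun_continuous _ _ _ (dot_bounded_functional p2) (G a p2).
  exact: (cvg_comp _ _ (cvg_comp _ _ (@cvgr_idn R) Jcvg) bcont).
by apply: (cvgr_to_le cvgJ); apply: nearW.
Qed.
End L1_semigroup.

(** * Potentials and transience *)

Section transience.
Context {d} {X : measurableType d} {R : realType}.
Context {mu : {measure set X -> \bar R}}.
Variables (T : R -> {linear L2 mu -> L2 mu}) (T1 : R -> {linear L1 mu -> L1 mu}).
Hypothesis T1_T : L1_extension T T1.

(** The opposite comparison: if [a = 1 / (N + 1)], the factor [expR (1 - a * t)] is at least 1 on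
    [[0, N]], so the truncated potential is at most [expR 1] times the resolvent at [a]. *)
Lemma potential_le_resolvent (G : R -> {linear L2 mu -> L2 mu}) (g1 : L1 mu)
    (g2 p2 : L2 mu) (I : nat -> L1 mu) (M : R) : semigroup_resolvent T G ->
  {ae mu, forall x, 0 <= g1 x} -> {ae mu, forall x, g1 x = g2 x} ->
  {ae mu, forall x, 0 <= p2 x <= 1} ->
  (forall N : nat, is_integral (fun t => T1 t g1) 0 N%:R (I N)) ->
  (forall a, 0 < a -> dot (G a g2) p2 <= M) ->
  forall N, \int[mu]_x (I N x * p2 x) <= expR 1 * M.
Proof.
move=> TG g1_ge0 g12 p01 gI GM N; pose a : R := N.+1%:R^-1.
have a0 : 0 < a by rewrite invr_gt0.
have [J [cJ Jcvg]] := TG a g2 a0.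
have N0 : 0 <= N%:R :> R by [].
have p2_ge0 : {ae mu, forall x, 0 <= p2 x} by apply: filterS p01 => x /andP[].
have p2_le1 : {ae mu, forall x, `|p2 x| <= 1}.
  by apply: filterS p01 => x /andP[? ?]; rewrite ger0_norm.
have bp1 := L1_bounded_functional (measurable_Lspace p2) p2_le1.
have bp2 := dot_bounded_functional (expR 1 *: p2).
have dotE u : dot u (expR 1 *: p2) = expR 1 * dot u p2.
  by rewrite dotC (bfunZ (dot_bounded_functional u)) dotC.
have Tp t : 0 <= t -> 0 <= dot (T t g2) p2.
  move=> t0; apply: dot_ge0 => //.
  have := L1_extension_ae T1_T t0 g12; have := L1_positivity T1_T t0 g1_ge0.
  by apply: filterS2 => x + <-.
have TE t : 0 <= t -> \int[mu]_x (T1 t g1 x * p2 x) = dot (T t g2) p2.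
  move=> t0; apply: ae_eq_Rintegral; last first.
    by apply: filterS (L1_extension_ae T1_T t0 g12) => x ->.
  - exact: measurable_L2M.
  - by apply: measurable_funM; exact: measurable_Lspace.
(* The resolvent is the limit of [J] at infinity, so the integral over [[0, N]] is compared with
   those over all longer [[0, m]], whose extra part is nonnegative. *)
have JM (m : nat) : (N <= m)%N -> \int[mu]_x (I N x * p2 x) <= expR 1 * dot (J m%:R) p2.
  move=> Nm; rewrite -dotE; have m0 : 0 <= m%:R :> R by [].
  apply: (integral_le bp1 bp2 N0 _ (gI N) (cJ _ m0)); first by rewrite ler_nat.
    move=> t /andP[t0 tN]; rewrite TE// dotE (bfunZ (dot_bounded_functional p2)) mulrA.
    rewrite ler_peMl ?Tp// -expRD -[leLHS]expR0 ler_expR subr_ge0.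
    rewrite /a mulrC ler_pdivrMr ?ltr0n// mul1r.
    by rewrite (le_trans tN)// ler_nat.
  move=> t /andP[Nt _]; have t0 := le_trans N0 Nt.
  by rewrite dotE (bfunZ (dot_bounded_functional p2)) !mulr_ge0 ?expR_ge0 ?Tp.
have cvgJ : expR 1 * dot (J m%:R) p2 @[m --> \oo] --> expR 1 * dot (G a g2) p2.
  apply: cvgMr.
  have bcont := @bfun_continuous _ _ _ (dot_bounded_functional p2) (G a g2).
  exact: (cvg_comp _ _ (cvg_comp _ _ (@cvgr_idn R) Jcvg) bcont).
apply: (@le_trans _ _ (expR 1 * dot (G a g2) p2)); last first.
  by rewrite ler_wpM2l ?expR_ge0// GM.
by apply: (cvgr_to_ge cvgJ); near=> m; apply: JM; near: m; exact: nbhs_infty_ge.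
Unshelve. all: by end_near. Qed.

(** Fatou's lemma makes the limit inferior of [I N * p1] integrable, hence finite almost everywhere.
    As the [I N] increase, it equals [Gg * p1], and [p1 > 0] then excludes the value [+oo] for
    [Gg]. *)
Lemma finite_potential (g p1 : L1 mu) (I : nat -> L1 mu) (M : R) :
  {ae mu, forall x, 0 <= g x} -> {ae mu, forall x, 0 < p1 x <= 1} ->
  (forall N : nat, is_integral (fun t => T1 t g) 0 N%:R (I N)) ->
  (forall N, \int[mu]_x (I N x * p1 x) <= M) ->
  exists2 Gg, is_potential T1 g Gg & {ae mu, forall x, (Gg x < +oo)%E}.
Proof.
move=> g0 p01 gI IM.
have I_nd := L1_potential_nondecreasing T1_T g0 gI.
have p_le1 : {ae mu, forall x, `|p1 x| <= 1}.
  by apply: filterS p01 => x /andP[? ?]; rewrite ger0_norm// ltW.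
have iM N := L1_integrableM (I N) (measurable_Lspace p1) p_le1.
(* The absolute value gives nonnegativity at every point, as Fatou's lemma is applied here, whereas
   [I N * p1] is nonnegative only almost everywhere. *)
pose q N x := (`|I N x * p1 x|)%:E.
have mq N : measurable_fun setT (q N) by exact: measurable_int (integrable_norm (iM N)).
have intq N : (\int[mu]_x q N x <= M%:E)%E.
  rewrite -(fineK (integrable_fin_num measurableT (integrable_norm (iM N)))) lee_fin.
  rewrite (le_trans _ (IM N))// le_eqVlt; apply/orP; left; apply/eqP.
  apply: ae_eq_Rintegral.
  - exact: integrable_measurable (integrable_norm (iM N)).
  - exact: integrable_measurable (iM N).
  - by apply: filterS2 I_nd p01 => x /(_ N)/andP[? _] /andP[? _];
      rewrite /= ger0_norm// mulr_ge0// ltW.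
have q0 N x : setT x -> (0 <= q N x)%E by rewrite lee_fin.
have iq : mu.-integrable setT (fun x => limn_einf (q ^~ x)).
  apply/integrableP; split.
    apply: measurableT_comp => //; apply: measurable_fun_limn_esup => N.
    exact: measurableT_comp.
  under eq_integral => x _.
    rewrite gee0_abs; last first.
      by rewrite limn_einf_lim; apply: lime_ge; [exact: is_cvg_einfs|
        apply: nearW => n; apply: le_ereal_inf_tmp => _ [m _ <-]; exact: q0].
    over.
  apply: (le_lt_trans (fatou mu measurableT mq q0)).
  apply: (@le_lt_trans _ _ M%:E); last exact: ltry.
  rewrite (le_trans (limn_einf_sup _))// limn_esup_lim.
  apply: lime_le; first exact: is_cvg_esups.
  by apply: nearW => n; apply: ge_ereal_sup => _ [m _ <-].
pose Gg x := limn_esup (fun N => (I N x)%:E).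
have cvgI : {ae mu, forall x, (I N x)%:E @[N --> \oo] --> Gg x}.
  apply: filterS I_nd => x Ix; rewrite /Gg.
  have ndI : nondecreasing_seq (fun N => (I N x)%:E).
    by apply/nondecreasing_seqP => N; rewrite lee_fin; case/andP : (Ix N).
  have cI : cvgn (fun N => (I N x)%:E) by exact: ereal_nondecreasing_is_cvgn.
  by rewrite is_cvg_limn_esupE.
exists Gg; first by exists I.
have qfin : {ae mu, forall x, limn_einf (q ^~ x) \is a fin_num}.
  by apply: filterS (integrable_ae measurableT iq) => x /(_ Logic.I).
have Ip : {ae mu, forall x, (forall N, 0 <= I N x <= I N.+1 x) /\ 0 < p1 x <= 1}.
  by apply: filterS2 I_nd p01 => x.
apply: filterS3 cvgI qfin Ip => x cIx qx [Ix /andP[p0 _]].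
have qE : q ^~ x = (fun N => (I N x)%:E * (p1 x)%:E)%E.
  apply/funext => N; rewrite /q ger0_norm ?EFinM// mulr_ge0// ?(ltW p0)//.
  by case/andP : (Ix N).
have cq : q N x @[N --> \oo] --> (Gg x * (p1 x)%:E)%E.
  by rewrite qE; apply: cvgeZr.
move: qx; rewrite (is_cvg_limn_einfE (cvgP _ cq)) (cvg_lim _ cq)//.
by case: (Gg x) => [r||]; rewrite ?ltry// mulyr gtr0_sg// mul1e.
Qed.

(* The weight is [min |h| 1 * exp (- phi)] with [phi] the potential of [h]:
   since [phi * exp (- phi) <= 1], the potential of [h] has integral at most
   [|h|] against it. *)
Lemma transient_weight (G : R -> {linear L2 mu -> L2 mu}) :
  semigroup_resolvent T G -> transient T1 ->
  exists p1 : L1 mu, exists p2 : L2 mu, exists M : R,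
    [/\ {ae mu, forall x, 0 < p1 x <= 1}, {ae mu, forall x, p2 x = p1 x} &
        forall a, 0 < a -> dot (G a p2) p2 <= M].
Proof.
move=> TG [h h0 [Gh [I [hI IGh]] Ghfin]].
have h_ge0 : {ae mu, forall x, 0 <= h x} by apply: filterS h0 => x /ltW.
have I_nd := L1_potential_nondecreasing T1_T h_ge0 hI.
(* A real-valued measurable version of the potential of [h]: [fine] alters the limit superior only
   on a null set, as the potential is finite almost everywhere. *)
pose phi x := fine (limn_esup (fun N => (I N x)%:E)).
have mphi : measurable_fun setT phi.
  apply: measurableT_comp => //; apply: measurable_fun_limn_esup => N.
  by apply/measurable_EFinP; exact: measurable_Lspace.
have Iphi : {ae mu, forall x, forall N, 0 <= I N x <= phi x}.
  apply: filterS3 I_nd IGh Ghfin => x Ix cIx Gx N.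
  have ndI : nondecreasing_seq (fun N => (I N x)%:E).
    by apply/nondecreasing_seqP => n; rewrite lee_fin; case/andP : (Ix n).
  have IG n : ((I n x)%:E <= Gh x)%E.
    by apply: (cvge_to_ge cIx); exists n => // m /= nm; exact: ndI.
  have /andP[I0 _] := Ix N; rewrite I0 -lee_fin /phi.
  rewrite (is_cvg_limn_esupE (cvgP _ cIx)) (cvg_lim _ cIx)//.
  rewrite fineK ?IG// fin_numElt Gx andbT.
  by rewrite (lt_le_trans _ (IG N))// ltNyr.
(* With absolute values the bounds on [w] hold at every point; almost everywhere [h] is positive and
   [phi] nonnegative. *)
pose w x := Num.min `|h x| 1 * expR (- `|phi x|).
have min0 x : 0 <= Num.min `|h x| 1 by rewrite le_min normr_ge0 ler01.
have exp_le1 x : expR (- `|phi x|) <= 1 by rewrite -[leRHS]expR0 ler_expR oppr_le0.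
have w0 x : 0 <= w x by rewrite mulr_ge0// expR_ge0.
have w_le x : w x <= Num.min `|h x| 1 by rewrite ler_piMr.
have wh x : w x <= `|h x| by rewrite (le_trans (w_le x))// ge_min lexx.
have w1 x : w x <= 1 by rewrite (le_trans (w_le x))// ge_min lexx orbT.
have phiw x : `|phi x| * w x <= `|h x|.
  rewrite mulrCA (@le_trans _ _ (Num.min `|h x| 1))//; last by rewrite ge_min lexx.
  rewrite ler_piMr//.
  rewrite expRN ler_pdivrMr ?expR_gt0// mul1r (le_trans _ (expR_ge1Dx _))//.
  by rewrite lerDr.
have mw : measurable_fun setT w.
  apply: measurable_funM.
    by apply: measurable_minr => //; apply: measurableT_comp => //; exact: measurable_Lspace.
  by apply: measurableT_comp => //; apply: measurableT_comp => //; exact: measurableT_comp.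
have iw : mu.-integrable setT (EFin \o w).
  apply: (ae_le_integrable mw (L1_integrable_norm h)); apply: aeW => x.
  by rewrite ger0_norm.
have [p1 p1w] := L1_ex iw.
have w2 : w \in Lfun mu 2%:E.
  apply: Lfun2_sqr => //; apply: (ae_le_integrable (measurable_funX _ mw) iw).
  by apply: aeW => x; rewrite normrX ger0_norm// expr2 ler_piMl.
have [p2 p2w] := Lspace_ex (p1 := lee1n 2) w2.
exists p1, p2, `|h|; split.
- apply: filterS2 p1w h0 => x -> hx; rewrite w1 andbT mulr_gt0 ?expR_gt0//.
  by rewrite lt_min ltr01 normr_gt0 gt_eqF.
- by apply: filterS2 p1w p2w => x -> ->.
apply: (resolvent_potential_le T1_T (h := h) (p1 := p1) (I := I)) => //.
  apply: filterS3 p1w p2w h0 => x p1x p2x hx.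
  by rewrite p2x p1x w0 w1; split => //; rewrite (le_trans (wh x))// gtr0_norm.
have p2_le1 : {ae mu, forall x, `|p2 x| <= 1}.
  by apply: filterS p2w => x ->; rewrite ger0_norm.
move=> N; rewrite L1_norm; apply: ae_le_Rintegral.
- by apply: L1_integrableM => //; exact: measurable_Lspace.
- exact: L1_integrable_norm.
apply: filterS2 p2w Iphi => x -> /(_ N)/andP[I0 Iphix].
by rewrite (le_trans _ (phiw x))// ler_wpM2r// (le_trans Iphix)// ler_norm.
Qed.
End transience.

(** * Energy estimate for the sectorial form and conclusion *)

Lemma form_estimate {d} {X : measurableType d} {R : realType}
    {mu : {measure set X -> \bar R}} (E : L2 mu -> L2 mu -> R) (V : set (L2 mu))
    (G : R -> {linear L2 mu -> L2 mu}) (p : L2 mu) (M : R) :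
  Dirichlet_form E V -> sectorial E V -> form_resolvent E V G ->
  (forall a, 0 < a -> dot (G a p) p <= M) ->
  exists2 C, 0 <= C & forall u, V u -> dot p u <= C * Num.sqrt (E u u).
Proof.
move=> E_form [K K0 EK] GE GM; exists (K * Num.sqrt M).
  by rewrite mulr_ge0 ?sqrtr_ge0// ltW.
move=> u Vu; apply/ler_addgt0Pr => e e0.
have c0 : 0 < Num.sqrt M * `|u| + 1 by rewrite ltr_wpDl// mulr_ge0// sqrtr_ge0.
(* The parameter of the resolvent is [s ^+ 2]. Since [s * |v|] will be at most [Num.sqrt M], the
   term [s ^+ 2 * dot v u] is at most [s * Num.sqrt M * |u|], hence at most [e]. *)
pose s := e / (Num.sqrt M * `|u| + 1); have s0 : 0 < s by rewrite divr_gt0.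
have a0 : 0 < s ^+ 2 by rewrite exprn_gt0.
have [Vv vE] := GE _ p a0; set v := G (s ^+ 2) p in Vv vE.
(* The resolvent equation tested with [v] itself; both terms on the left are nonnegative, so each is
   bounded by [M]. *)
have vM : E v v + (s * `|v|) ^+ 2 <= M.
  by rewrite exprMn L2_norm vE// dotC GM.
have Ev0 := form_ge0 E_form Vv.
have sv2 : 0 <= (s * `|v|) ^+ 2 by exact: sqr_ge0.
have M0 : 0 <= M by lra.
have sv : s * `|v| <= Num.sqrt M.
  have sv0 : 0 <= s * `|v| by apply: mulr_ge0 => //; exact: ltW.
  rewrite -(ler_pXn2r (n := 2)) ?nnegrE ?sqrtr_ge0//.
  by rewrite sqr_sqrtr//; lra.
have Evu : E v u <= K * Num.sqrt M * Num.sqrt (E u u).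
  apply: (le_trans (ler_norm _)); apply: (le_trans (EK _ _ Vv Vu)).
  by rewrite ler_wpM2r ?sqrtr_ge0// ler_wpM2l ?(ltW K0)// ler_wsqrtr//; lra.
rewrite -(vE _ Vu) lerD//.
apply: (@le_trans _ _ (s ^+ 2 * (`|v| * `|u|))).
  rewrite ler_wpM2l ?(ltW a0)//.
  exact: le_trans (ler_norm _) (CauchySchwarz_dot _ _).
have -> : s ^+ 2 * (`|v| * `|u|) = s * (s * `|v| * `|u|) by ring.
apply: (@le_trans _ _ (s * (Num.sqrt M * `|u|))).
  by rewrite ler_wpM2l ?(ltW s0)// ler_wpM2r.
by rewrite /s mulrAC ler_pdivrMr// ler_wpM2l ?(ltW e0)// lerDl.
Qed.

(** The value of [L] at [G a f] must be [a *: G a f - f]; the resolvent identity checks the defining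
    condition of the generator for every [b > 0]. *)
Lemma resolvent_generator_dom (R : realType) (B : normedModType R)
    (G : R -> {linear B -> B}) (D : set B) (L : B -> B) (a : R) (f : B) :
  C0_contraction_resolvent G -> resolvent_generator G D L -> 0 < a -> D (G a f).
Proof.
move=> [GD _ _] GL a0.
suff [] : D (G a f) /\ L (G a f) = a *: G a f - f by [].
apply/GL => b b0; rewrite linearB linearZ linearB linearZ/=.
have -> : b *: G b (G a f) - (a *: G b (G a f) - G b f) =
    G b f - (a - b) *: G b (G a f) by rewrite scalerBl !opprB addrCA.
by rewrite -GD// opprB addrC subrK.
Qed.

(** From [0 < p <= 1] follows [p ^+ 4 <= p ^+ 2 <= p], so the square of [p] is integrable and square
    integrable. *)
Lemma L1_L2_sqr_ex {d} {X : measurableType d} {R : realType}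
    {mu : {measure set X -> \bar R}} (p : L1 mu) :
  {ae mu, forall x, 0 < p x <= 1} -> exists (g1 : L1 mu) (g2 : L2 mu),
    {ae mu, forall x, g1 x = p x ^+ 2} /\ {ae mu, forall x, g2 x = p x ^+ 2}.
Proof.
move=> p01; have mp := measurable_Lspace p.
have i2 : mu.-integrable setT (EFin \o (fun x => p x ^+ 2)).
  apply: (ae_le_integrable (measurable_funX _ mp) (L1_integrable p)).
  by apply: filterS p01 => x /andP[/ltW p0 p1]; rewrite normrX ger0_norm// expr2 ler_piMr.
have [g1 g1E] := L1_ex i2.
have /(Lspace_ex (p1 := lee1n 2))[g2 g2E] : (fun x => p x ^+ 2) \in Lfun mu 2%:E.
  apply: Lfun2_sqr; first exact: measurable_funX.
  apply: (ae_le_integrable _ i2); first by do 2 apply: measurable_funX.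
  apply: filterS p01 => x /andP[/ltW p0 p1].
  by rewrite normrX ger0_norm ?sqr_ge0// expr2 ler_piMr ?sqr_ge0// expr_le1.
by exists g1, g2.
Qed.

Theorem theorem4 (R : realType) (E : ptopologicalType)
    (hausE : hausdorff_space E)
    (borelE : borel_generated_by_continuous R E)
    (mu : {measure set (borelType E) -> \bar R})
    (sigma_finite_mu : sigma_finite setT mu)
    (* the Dirichlet form (A, V) *)
    (A : L2 mu -> L2 mu -> R) (V : set (L2 mu))
    (A_form : Dirichlet_form A V)
    (* the operator (Lam, DLam) and the semigroup U it generates *)
    (DLam : set (L2 mu)) (Lam : L2 mu -> L2 mu)
    (U : R -> {linear L2 mu -> L2 mu})
    (U_C0 : C0_contraction_semigroup U)
    (U_markov : forall t : R, 0 <= t -> sub_Markovian (U t))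
    (U_gen : semigroup_generator U DLam Lam)
    (U_V : restricts_to_C0_semigroup A V U)
    (* the resolvent of the generalized Dirichlet form, and its adjoint *)
    (G Gh : R -> {linear L2 mu -> L2 mu})
    (G_C0 : C0_contraction_resolvent G)
    (G_markov : forall a : R, 0 < a -> sub_Markovian (a \*: G a))
    (G_form : gen_form_resolvent A V DLam Lam G)
    (G_adj : adjoint_family G Gh)
    (* the generator of G *)
    (DL : set (L2 mu)) (L : L2 mu -> L2 mu)
    (G_gen : resolvent_generator G DL L)
    (* the semigroups corresponding to G and Gh *)
    (T Th : R -> {linear L2 mu -> L2 mu})
    (T_C0 : C0_contraction_semigroup T)
    (T_G : semigroup_resolvent T G)
    (Th_C0 : C0_contraction_semigroup Th)
    (Th_Gh : semigroup_resolvent Th Gh)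
    (Th_markov : forall t : R, 0 <= t -> sub_Markovian (Th t))
    (* the extension of T to L^1 *)
    (T1 : R -> {linear L1 mu -> L1 mu})
    (T1_T : L1_extension T T1)
    (* the sectorial Dirichlet form (E0, DE0) *)
    (E0 : L2 mu -> L2 mu -> R) (DE0 : set (L2 mu))
    (E0_form : Dirichlet_form E0 DE0)
    (E0_sectorial : sectorial E0 DE0)
    (DLb_E0 : forall u, DL u -> ae_bounded u -> DE0 u)
    (E0_le_E : forall u, DL u -> ae_bounded u ->
       E0 u u <= gen_form A V DLam Lam u u) :
  transient_form E0 DE0 -> transient T1.
Proof.
case=> [G0 [T0 [T01 [[_ G0_form] [_ T0_G0] T01_T0 T01_transient]]]].
have [p1 [p2 [M [p01 p12 G0M]]]] := transient_weight T01_T0 T0_G0 T01_transient.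
have [C C0 CE0] := form_estimate E0_form E0_sectorial G0_form G0M.
have [g1 [g2 [g1E g2E]]] := L1_L2_sqr_ex p01.
have p2_01 : {ae mu, forall x, 0 <= p2 x <= 1}.
  by apply: filterS2 p01 p12 => x /andP[/ltW ? ?] ->; apply/andP.
have g2_le_p2 : {ae mu, forall x, 0 <= g2 x <= p2 x}.
  apply: filterS3 g2E p12 p2_01 => x -> <- /andP[p0 ple1].
  by rewrite sqr_ge0 expr2 ler_piMl.
have g1_ge0 : {ae mu, forall x, 0 <= g1 x}.
  by apply: filterS g1E => x ->; exact: sqr_ge0.
have Gg_le a : 0 < a -> dot (G a g2) p2 <= C ^+ 2.
  move=> a0; set u := G a g2.
  (* Since [g2 <= p2 <= 1], the sub-Markov property of [a \*: G a] bounds [u] by [a^-1]; this places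
     [u] among the bounded elements of [DL], to which the domination hypothesis applies. *)
  have u_bound : {ae mu, forall x, 0 <= u x <= a^-1}.
    have /(G_markov _ a0) : {ae mu, forall x, 0 <= g2 x <= 1}.
      by apply: filterS2 g2_le_p2 p2_01 => x /andP[-> h] /andP[_ /(le_trans h)].
    apply: filterS2 (LspaceZ a u) => x + /andP[]; rewrite -/u => -> au0 au1.
    by rewrite -(ler_pM2l a0) mulr0 au0/= -(ler_pM2l a0) divff ?gt_eqF.
  have DLu : DL u := resolvent_generator_dom g2 G_C0 G_gen a0.
  have bu : ae_bounded u.
    by exists a^-1; apply: filterS u_bound => x /andP[u0 ?]; rewrite ger0_norm.
  (* Membership of [u] in the closure domain includes [V u], so the resolvent equation may be tested
     with [u] itself. *)
  have [[phi [Vu _ _]] /(_ u Vu) Euu] := G_form _ g2 a0.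
  have E0u : E0 u u <= dot g2 u.
    rewrite (le_trans (E0_le_E _ DLu bu))// -Euu lerDl mulr_ge0 ?(ltW a0)//.
    by rewrite -L2_norm sqr_ge0.
  have g2u : dot g2 u <= dot p2 u.
    apply: ae_le_Rintegral; [exact: L2_integrableM|exact: L2_integrableM|].
    by apply: filterS2 g2_le_p2 u_bound => x /andP[_ gp] /andP[u0 _]; exact: ler_wpM2r.
  rewrite dotC; set y := dot p2 u.
  (* For positive [y] the inequality [y <= C * Num.sqrt y] can be divided by [Num.sqrt y], which
     gives a bound independent of [a]. *)
  have [y0|y0] := leP y 0; first by rewrite (le_trans y0)// sqr_ge0.
  have s0 : 0 < Num.sqrt y by rewrite sqrtr_gt0.
  have : y <= C * Num.sqrt y.
    apply: (le_trans (CE0 _ (DLb_E0 _ DLu bu))); rewrite ler_wpM2l// ler_wsqrtr//.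
    exact: le_trans g2u.
  rewrite -{1}(sqr_sqrtr (ltW y0)) expr2 ler_pM2r// => sC.
  by rewrite -(sqr_sqrtr (ltW y0)) ler_pXn2r ?nnegrE ?(ltW s0).
have g12 : {ae mu, forall x, g1 x = g2 x}.
  by apply: filterS2 g1E g2E => x -> ->.
have pg : {ae mu, forall x, [/\ 0 <= p1 x, p2 x = p1 x, g1 x = p1 x ^+ 2 & g2 x = g1 x]}.
  have p1_ge0 : {ae mu, forall x, 0 <= p1 x /\ p2 x = p1 x}.
    by apply: filterS2 p01 p12 => x /andP[/ltW].
  by apply: filterS3 p1_ge0 g1E g12 => x [].
have /choice[I gI] (N : nat) : exists I, is_integral (fun t => T1 t g1) 0 N%:R I.
  exact: (L1_extension_integral_ex T1_T T_C0 (ler0n _ N) pg).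
have bound := potential_le_resolvent T1_T T_G g1_ge0 g12 p2_01 gI Gg_le.
have [N|Gg Gg_pot Gg_fin] :=
  finite_potential (M := expR 1 * C ^+ 2) T1_T g1_ge0 p01 gI.
  (* The bound is stated with the L^2 representative [p2] of the weight and is transferred to the
     L^1 representative [p1]. *)
  apply: le_trans (bound N); rewrite le_eqVlt; apply/orP; left; apply/eqP.
  apply: ae_eq_Rintegral; last by apply: filterS p12 => x ->.
  - by apply: measurable_funM; exact: measurable_Lspace.
  - by apply: measurable_funM; exact: measurable_Lspace.
exists g1; last by exists Gg.
by apply: filterS2 g1E p01 => x -> /andP[p0 _]; rewrite exprn_gt0.
Qed.
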